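(* Let $X$ be a one-dimensional irreducible shift of finite type, $(X,\phi)$ a cellular automaton, and $\mu$ a $\sigma$-ergodic Borel probability measure on $X$ with $\mu(EQ(\phi))=1$. Let $\mu_\infty$ be the weak limit of $\frac1n\sum_{i=1}^n\phi^i\mu$ as $n\to\infty$. Then $\mu_\infty$ is the measure of maximal entropy of $X$ if and only if $\mu$ is the measure of maximal entropy of $X$ and $\phi$ is surjective.
   Context: $\mathcal{A}$ is a finite alphabet. $\mathcal{A}^{\mathbb{Z}}$ has the product topology and the shift $\sigma$, $(\sigma x)_j=x_{j+1}$. A one-dimensional subshift is a closed $\sigma$-invariant set $X\subset\mathcal{A}^{\mathbb{Z}}$; it is a shift of finite type (SFT) if it is the set of all sequences in which no pattern from some finite list of forbidden words appears. It is irreducible if for all nonempty cylinder sets $U,V\subset X$ there is $j\ge1$ with $\sigma^jU\cap V\ne\emptyset$. A cellular automaton (CA) $(X,\phi)$ is a subshift $X$ with a continuous map $\phi:X\to X$ commuting with $\sigma$. With $W_m=[-m,m]\cap\mathbb{Z}$, put $B_n(x)=\{y\in X: y_{W_n}=x_{W_n}\}$ and $O_m(x)=\{y\in X: (\phi^i y)_{W_m}=(\phi^i x)_{W_m}\ \forall i\ge0\}$. A point $x\in X$ is an equicontinuity point of $\phi$ if for every $m$ there is $n$ with $B_n(x)\subset O_m(x)$; $EQ(\phi)$ is the set of equicontinuity points. $\phi^i\mu$ is the push-forward of $\mu$ under $\phi^i$. Weak convergence is convergence of integrals of continuous functions; the weak limit $\mu_\infty$ exists under the stated hypotheses. $\sigma$-ergodic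 means $\sigma$-invariant and ergodic for $\sigma$. A measure of maximal entropy (MME) is a $\sigma$-invariant Borel probability measure whose measure-theoretic entropy with respect to $\sigma$ equals the topological entropy of $(X,\sigma)$; an irreducible one-dimensional SFT has a unique MME, and it has full support (Shannon–Parry). *)

(* Defs.v *)
From HB Require Import structures.
From mathcomp Require Import all_boot all_order all_algebra.
From mathcomp Require Import all_classical all_reals all_analysis.
Import Order.TTheory GRing.Theory Num.Theory.
Import numFieldNormedType.Exports.

Set Implicit Arguments.
Unset Strict Implicit.
Unset Printing Implicit Defensive.

Local Open Scope classical_set_scope.
Local Open Scope ring_scope.

Definition borel (T : ptopologicalType) := g_sigma_algebraType (@open T).

Section TopologicalEntropy.
Local Open Scope ereal_scope.
Variables (R : realType) (T : topologicalType) (S : T -> T).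
Implicit Type U : set (set T).

Definition open_cover U :=
  (forall V, U V -> open V) /\ \bigcup_(V in U) V = [set: T].

(* log N(U), with N(U) the least cardinality of a finite subcover of U
   (+oo if there is none). *)
Definition cover_entropy U : \bar R :=
  ereal_inf [set h | exists k : nat, exists V : 'I_k -> set T,
    [/\ forall i, U (V i), \bigcup_i V i = [set: T] & h = (ln k%:R)%:E]].

(* The join of U, S^-1 U, ..., S^-(n-1) U. *)
Definition cover_join U (n : nat) : set (set T) :=
  [set W | exists V : nat -> set T,
    (forall i, (i < n)%N -> U (V i)) /\
    W = \bigcap_(i in `I_n) (iter i S @^-1` V i)].

(* The sequence converges by subadditivity, so limn_esup is its limit; the
   same applies to partition_entropy_rate below. *)
Definition cover_entropy_rate U : \bar R :=
  limn_esup (fun n : nat => (n%:R^-1)%:E * cover_entropy (cover_join U n)).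

Definition topological_entropy : \bar R :=
  ereal_sup [set cover_entropy_rate U | U in open_cover].

End TopologicalEntropy.

Section MeasureTheoreticEntropy.
Local Open Scope ereal_scope.
Context d (T : measurableType d) (R : realType).
Variables (mu : probability T R) (S : T -> T).

(* A finite measurable partition is represented by its labelling function
   p : T -> I, the atoms being the fibres of p. As 0 * ln 0 = 0 here, null
   atoms do not contribute. *)
Definition partition_entropy (I : finType) (p : T -> I) : R :=
  (- \sum_(i : I) (let q := fine (mu (p @^-1` [set i])) in q * ln q))%R.

(* The labelling function of the join of p, S^-1 p, ..., S^-(n-1) p. *)
Definition partition_join (I : finType) (p : T -> I) (n : nat) (x : T) :
    {ffun 'I_n -> I} :=
  [ffun i : 'I_n => p (iter i S x)].

Definition partition_entropy_rate (I : finType) (p : T -> I) : \bar R :=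
  limn_esup (fun n : nat =>
    (n%:R^-1 * partition_entropy (@partition_join I p n))%:E).

Definition measure_entropy : \bar R :=
  ereal_sup [set h | exists k : nat, exists p : T -> 'I_k,
    (forall i, measurable (p @^-1` [set i])) /\ h = partition_entropy_rate p].

Definition invariant_measure :=
  forall B, measurable B -> mu (S @^-1` B) = mu B.

Definition ergodic_measure :=
  invariant_measure /\
  forall B, measurable B -> S @^-1` B = B -> mu B = 0 \/ mu B = 1.

(* (1/n) * sum_(i=1)^n S^i mu, as a set function: S need not be measurable. *)
Definition cesaro_mean (n : nat) : set T -> \bar R :=
  fun B => (n%:R^-1)%:E * \sum_(1 <= i < n.+1) pushforward mu (iter i S) B.

End MeasureTheoreticEntropy.

Definition weak_limit (R : realType) (T : ptopologicalType)
    (nu : nat -> set (borel T) -> \bar R) (mu : probability (borel T) R) :=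
  forall f : T -> R, continuous f ->
    (\int[nu n]_x (f x)%:E)%E @[n --> \oo] --> (\int[mu]_x (f x)%:E)%E.

Definition fullshift (A : finType) : topologicalType :=
  {ptws int -> discrete_topology A}.

Section Words.
Variable A : finType.
Implicit Type x : fullshift A.

Definition shift x : fullshift A := fun j : int => x (j + 1).

Definition word_at x (j : int) (k : nat) : seq A :=
  [seq (x (j + i%:Z) : A) | i <- iota 0 k].

Definition occurs (w : seq A) x := exists j : int, word_at x j (size w) = w.

Definition agree_on_window (m : nat) x (y : fullshift A) :=
  forall j : int, (`|j| <= m%:Z)%R -> x j = y j.

End Words.

(* Nonemptiness holds whenever there is a probability measure on the subshift;
   it is required here because measurable types are pointed. *)
Record subshift (A : finType) := Subshift {
  subshift_set :> set (fullshift A);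
  subshift_nonempty : subshift_set !=set0;
  subshift_closed : closed subshift_set;
  subshift_invariant : @shift A @` subshift_set = subshift_set }.

Definition points (A : finType) (X : subshift A) : Type :=
  set_type (subshift_set X).

Section Subshift.
Variables (A : finType) (X : subshift A).

HB.instance Definition _ := Topological.copy (points X)
  (set_type (subshift_set X)).

Let points_inhabited : exists x : points X, True.
Proof. by have [x Xx] := subshift_nonempty X; exists (SigSub (mem_set Xx)). Qed.

HB.instance Definition _ := isPointed.Build (points X)
  (projT1 (cid points_inhabited)).

Definition seq_of (x : points X) : fullshift A := val x.

Lemma shift_subshift (x : points X) : shift (seq_of x) \in subshift_set X.
Proof.
by apply: mem_set; rewrite -[Y in Y _]subshift_invariant; exists (seq_of x);
  [exact: set_valP|].
Qed.

Definition sigma (x : points X) : points X := SigSub (shift_subshift x).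

Definition is_SFT := exists F : seq (seq A),
  subshift_set X = [set x | forall w, w \in F -> ~ occurs w x].

Definition cylinder (j : int) (w : seq A) : set (points X) :=
  [set x | word_at (seq_of x) j (size w) = w].

Definition irreducible := forall (i j : int) (u v : seq A),
  cylinder i u !=set0 -> cylinder j v !=set0 ->
  exists2 k : nat, (1 <= k)%N &
    (iter k sigma @` cylinder i u) `&` cylinder j v !=set0.

Definition cellular_automaton (phi : points X -> points X) :=
  continuous phi /\ forall x, phi (sigma x) = sigma (phi x).

Definition ball_window (n : nat) (x : points X) : set (points X) :=
  [set y | agree_on_window n (seq_of y) (seq_of x)].

Definition orbit_window (phi : points X -> points X) (m : nat)
    (x : points X) : set (points X) :=
  [set y | forall i : nat,
    agree_on_window m (seq_of (iter i phi y)) (seq_of (iter i phi x))].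

Definition EQ (phi : points X -> points X) : set (points X) :=
  [set x | forall m : nat, exists n : nat,
    ball_window n x `<=` orbit_window phi m x].

Definition is_MME (R : realType) (mu : probability (borel (points X)) R) :=
  invariant_measure mu sigma /\
  measure_entropy mu sigma = topological_entropy R sigma.

End Subshift.

(* Main.v *)
Require Import Defs.
From HB Require Import structures.
From mathcomp Require Import all_boot all_order all_algebra.
From mathcomp Require Import all_classical all_reals all_analysis.
From mathcomp Require Import ring lra zify.

(* Count words. For a measure of maximal entropy nu on an irreducible SFT, the
   entropy of the words of length n is within a constant of ln |L_n|. Hence nu
   is absolutely continuous with respect to the uniform distribution on L_n,
   uniformly in n, and, since any word of L_n can be inserted in a window of
   length n + K of any point, nu gives every word of L_n mass at least g/|L_n|.
   So a measure with the first property is dominated by any measure with the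
   second one, and two such measures coincide when the dominating one is ergodic.

   If mu is the MME and phi is surjective, phi mu satisfies the lower bound,
   because the preimage of a cylinder contains a slightly longer one; as phi mu
   is ergodic, phi mu = mu, whence mu_inf = mu.

   Conversely, if mu_inf is the MME, it has full support, while the averages
   live on the closed set phi(X); so phi is surjective. Equicontinuity makes the
   coordinates x |-> (phi^i x)_0 precompact in measure, so up to a small Hamming
   distance the averages of phi^i mu mix finitely many measures phi^t mu with
   t <= T. This gives h(mu_inf) <= h(mu), so mu has the lower bound too and
   mu_inf = mu. *)

Import Order.TTheory GRing.Theory Num.Theory.
Import numFieldNormedType.Exports.

Set Implicit Arguments.
Unset Strict Implicit.
Unset Printing Implicit Defensive.

Local Open Scope classical_set_scope.
Local Open Scope ring_scope.

(** * Entropy of finite random variables *)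

(** Maximal entropy enters only through H_n >= ln |L_n| - c, where H_n is the entropy of n-words:
    H_n / n is at least the entropy by subadditivity, and ln |L_n| is superadditive up to a
    constant. The comparison of two measures is asymmetric, since the dominating one has to be
    ergodic. So [phi mu] dominates [mu] in one direction, and [mu] dominates [mu_inf], whose
    ergodicity is not known beforehand, in the other. The obstacle in the converse is that k-words
    of phi^i x are functions of (k + 2 r_i)-words of x with a radius r_i that may grow with i, so
    the resulting entropy bound is lost when the averages converge with k fixed. Replacing i by a
    time tau(i) <= T bounds the radius. The random time then costs ln (T+1), whatever the number of
    averaged terms, and the wrong letters cost k eta. The first cost disappears after division by k,
    and eta is arbitrary. *)

Lemma ln_prod (R : realType) (I : finType) (F : I -> R) :
  (forall i, 0 < F i) -> ln (\prod_i F i) = \sum_i ln (F i).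
Proof.
move=> F0; suff [] : 0 < \prod_i F i /\ ln (\prod_i F i) = \sum_i ln (F i) by [].
apply: (big_ind2 (fun a b => 0 < a /\ ln a = b)); first by rewrite ln1.
  by move=> a1 b1 a2 b2 [a10 <-] [a20 <-]; rewrite mulr_gt0// lnM.
by move=> i _; split.
Qed.

Section FiniteEntropy.
Variables (R : realType) (Om : finType) (p : Om -> R).
Hypothesis p_ge0 : forall w, 0 <= p w.
Hypothesis p_sum : \sum_w p w = 1.

Definition law_of (I : finType) (X : Om -> I) (i : I) : R :=
  \sum_(w | X w == i) p w.

Definition entropy_of (I : finType) (X : Om -> I) : R :=
  - \sum_i law_of X i * ln (law_of X i).

Lemma law_of_ge0 (I : finType) (X : Om -> I) i : 0 <= law_of X i.
Proof. exact: sumr_ge0. Qed.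

Lemma law_of_sum (I : finType) (X : Om -> I) (g : I -> R) :
  \sum_i law_of X i * g i = \sum_w p w * g (X w).
Proof.
rewrite (partition_big X xpredT) //=; apply: eq_bigr => i _.
by rewrite /law_of big_distrl /=; apply: eq_bigr => w /eqP ->.
Qed.

Lemma law_of_sum1 (I : finType) (X : Om -> I) : \sum_i law_of X i = 1.
Proof.
rewrite -p_sum -[RHS](eq_bigr _ (fun w _ => mulr1 (p w))).
by rewrite -(law_of_sum X (fun=> 1)); apply: eq_bigr => i _; rewrite mulr1.
Qed.

Lemma entropy_ofE (I : finType) (X : Om -> I) :
  entropy_of X = - \sum_w p w * ln (law_of X (X w)).
Proof. by rewrite /entropy_of (law_of_sum X (fun i => ln (law_of X i))). Qed.

Lemma law_of_gt0 (I : finType) (X : Om -> I) w : p w != 0 -> 0 < law_of X (X w).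
Proof.
move=> pw; rewrite /law_of (bigD1 w) //=.
by rewrite ltr_pwDl ?sumr_ge0// lt_neqAle eq_sym pw p_ge0.
Qed.

(* Gibbs' inequality applied to the sub-probability law(Z) * kappa. *)
Lemma entropy_le_code (I J : finType) (X : Om -> I) (Z : Om -> J)
    (kappa : J -> I -> R) :
  (forall z i, 0 <= kappa z i) -> (forall z, \sum_i kappa z i <= 1) ->
  (forall w, p w != 0 -> 0 < kappa (Z w) (X w)) ->
  entropy_of X <= entropy_of Z - \sum_w p w * ln (kappa (Z w) (X w)).
Proof.
move=> k0 k1 kpos; rewrite !entropy_ofE -opprD lerN2 -big_split /=.
pose y w := law_of Z (Z w) * kappa (Z w) (X w) / law_of X (X w).
have key w : p w * ln (law_of Z (Z w)) + p w * ln (kappa (Z w) (X w))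
   <= p w * ln (law_of X (X w)) + (p w * y w - p w).
  have [->|pw] := eqVneq (p w) 0; first by rewrite !mul0r subrr !addr0.
  have lX := law_of_gt0 X pw; have lZ := law_of_gt0 Z pw; have kw := kpos _ pw.
  have yE : ln (y w) = ln (law_of Z (Z w)) + ln (kappa (Z w) (X w))
      - ln (law_of X (X w)).
    by rewrite /y ln_div ?lnM ?posrE// mulr_gt0.
  have y0 : 0 < y w by rewrite /y divr_gt0// mulr_gt0.
  have := @le_ln1Dx R (y w - 1); rewrite [1 + _]addrC subrK => H.
  have {}H : ln (y w) <= y w - 1 by apply: H; lra.
  rewrite -mulrDr -[X in _ - X]mulr1 -mulrBr -mulrDr ler_wpM2l//; lra.
apply: (le_trans (ler_sum _ (fun w _ => key w))).
rewrite big_split /= gerDl sumrB p_sum subr_le0.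
rewrite (partition_big X xpredT) //=.
have -> : \sum_i \sum_(w | X w == i) p w * y w =
  \sum_i \sum_z law_of (fun w => (X w, Z w)) (i, z) *
     (law_of Z z * kappa z i / law_of X i).
  apply: eq_bigr => i _; rewrite (partition_big Z xpredT) //=.
  apply: eq_bigr => z _; rewrite /law_of big_distrl /=.
  by apply: eq_big => [w|w /andP[/eqP <- /eqP <-]]; rewrite ?xpair_eqE.
apply: (@le_trans _ _ (\sum_i \sum_z law_of Z z * kappa z i)).
  apply: ler_sum => i _; apply: ler_sum => z _.
  have q0 : 0 <= law_of Z z * kappa z i by rewrite mulr_ge0// law_of_ge0.
  have [e|ne] := eqVneq (law_of X i) 0; first by rewrite e invr0 !mulr0.
  have X0 : 0 < law_of X i by rewrite lt_neqAle eq_sym ne law_of_ge0.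
  rewrite mulrA ler_pdivrMr// mulrC ler_wpM2l//.
  rewrite /law_of big_mkcond [leRHS]big_mkcond; apply: ler_sum => w _.
  by rewrite xpair_eqE; case: (X w == i) => //=; case: ifP.
rewrite exchange_big /= -(law_of_sum1 Z); apply: ler_sum => z _.
by rewrite -big_distrr /= ler_piMr// law_of_ge0.
Qed.

Lemma entropy_of_le_cross (I : finType) (X : Om -> I) (r : I -> R) :
  (forall i, 0 <= r i) -> \sum_i r i <= 1 ->
  (forall w, p w != 0 -> 0 < r (X w)) ->
  entropy_of X <= - \sum_w p w * ln (r (X w)).
Proof.
move=> r0 r1 rpos.
have := @entropy_le_code _ _ X (fun=> tt) (fun=> r) (fun=> r0) (fun=> r1) rpos.
suff -> : entropy_of (fun=> tt) = 0 by rewrite sub0r.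
rewrite entropy_ofE big1 ?oppr0// => w _.
by rewrite /law_of (eq_bigl xpredT)// p_sum ln1 mulr0.
Qed.

Lemma entropy_of_factor (I J : finType) (Z : Om -> J) (f : J -> I) :
  entropy_of (fun w => f (Z w)) <= entropy_of Z.
Proof.
have := @entropy_le_code _ _ (fun w => f (Z w)) Z
  (fun z i => (f z == i)%:R) (fun z i => ler0n _ _).
rewrite big1 => [|w _]; last by rewrite eqxx ln1 mulr0.
rewrite subr0; apply=> [z|w _]; last by rewrite eqxx.
by rewrite (bigD1 (f z))//= eqxx big1 ?addr0// => i; rewrite eq_sym => /negPf ->.
Qed.

Lemma entropy_of_pair (I J : finType) (X : Om -> I) (Z : Om -> J) :
  entropy_of (fun w => (Z w, X w)) <= entropy_of Z + entropy_of X.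
Proof.
have := @entropy_le_code _ _ (fun w => (Z w, X w)) Z
  (fun z i => (i.1 == z)%:R * law_of X i.2).
rewrite [entropy_of X]entropy_ofE.
under [X in _ -> _ -> _ -> (_ <= _ - X)%R]eq_bigr do rewrite /= eqxx mul1r.
apply=> [z i|z|w pw] /=; first by rewrite mulr_ge0// law_of_ge0.
  rewrite -(@pair_big _ _ _ _ _ xpredT xpredT
    (fun a b => (a == z)%:R * law_of X b)) /=.
  rewrite (bigD1 z)//= eqxx [X in _ + X]big1 => [|a /negPf ->]; last first.
    by rewrite big1// => b _; rewrite mul0r.
  by rewrite addr0 -big_distrr /= law_of_sum1 mulr1.
by rewrite eqxx mul1r law_of_gt0.
Qed.

Lemma entropy_of_le_card (I : finType) (X : Om -> I) (E : {set I}) :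
  (forall w, p w != 0 -> X w \in E) -> entropy_of X <= ln #|E|%:R.
Proof.
move=> XE.
have E0 : (0 < #|E|)%N.
  rewrite card_gt0; apply/set0Pn.
  have [/existsP[w pw]|/existsPn H] := boolP [exists w, p w != 0].
    by exists (X w); exact: XE.
  move: p_sum; rewrite big1 => [/eqP|w _]; first by rewrite eq_sym oner_eq0.
  by apply/eqP; rewrite -[_ == _]negbK H.
have := @entropy_of_le_cross _ X (fun i => (i \in E)%:R / #|E|%:R).
have -> : - (\sum_w p w * ln ((X w \in E)%:R / #|E|%:R)) = ln (#|E|%:R : R).
  rewrite -sumrN -[RHS]mul1r -[X in _ = X * _]p_sum big_distrl /=; apply: eq_bigr => w _.
  have [->|pw] := eqVneq (p w) 0; first by rewrite !mul0r oppr0.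
  by rewrite XE// mul1r lnV ?posrE ?ltr0n// mulrN opprK.
apply=> [i||w pw]; first by rewrite mulr_ge0// invr_ge0 ler0n.
  rewrite -big_distrl /= -natr_sum -big_mkcond /= sum1_card divff//.
  by rewrite pnatr_eq0 -lt0n.
by rewrite XE// mul1r invr_gt0 ltr0n.
Qed.

End FiniteEntropy.

(** * Entropy of a word known up to few wrong letters *)

Section Hamming.
Variables (R : realType) (I : finType).

(** A Fano-type bound. Given Z, the kernel draws an index t uniformly, at a cost ln (T+1), and then
    predicts the letters of [F t Z] independently, each with a small error rate. Only the error
    probability of each single coordinate matters, so [eps] depends on [eta] and [I] alone. *)
Lemma entropy_of_hamming (eta : R) : 0 < eta -> exists2 eps, 0 < eps &
  forall (Om : finType) (p : Om -> R), (forall w, 0 <= p w) ->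
    \sum_w p w = 1 ->
  forall n (X : Om -> {ffun 'I_n -> I}) (J : finType) (Z : Om -> J) T
    (F : 'I_T.+1 -> J -> {ffun 'I_n -> I}) (tau : Om -> 'I_T.+1),
  (forall j, \sum_(w | X w j != F (tau w) (Z w) j) p w <= eps) ->
  entropy_of p X <= entropy_of p Z + ln T.+1%:R + n%:R * eta.
Proof.
move=> eta0.
(* A correct letter costs -ln (1 - del) = eta/2, a wrong one ln (K / del); [eps] bounds the expected
   cost of wrong letters by eta/2 per coordinate. *)
pose del : R := 1 - expR (- (eta / 2)).
have del1 : del < 1 by rewrite /del ltrBlDr ltrDl expR_gt0.
have del0 : 0 < del by rewrite /del subr_gt0 expR_lt1; lra.
have lndel : ln (1 - del) = - (eta / 2) by rewrite /del subKr expRK.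
pose K : R := #|I|%:R.
pose k (b a : I) : R := if a == b then 1 - del else del / K.
pose eps := eta / 2 / (1 + `|ln (K / del)|).
have eps0 : 0 < eps by rewrite divr_gt0 ?ltr_pwDl //; lra.
have epsK : eps * `|ln (K / del)| <= eta / 2.
  rewrite /eps -[leRHS]mulr1 -mulrA ler_wpM2l//; first lra.
  by rewrite mulrC ler_pdivrMr ?mul1r ?lerDr// ltr_pwDl.
exists eps => // Om p p0 p1 n X J Z T F tau Heps.
have K0 (a : I) : 0 < K by rewrite ltr0n; apply/card_gt0P; exists a.
have k0 b a : 0 < k b a.
  by rewrite /k; case: eqP => _; [rewrite subr_gt0|rewrite divr_gt0// (K0 a)].
have k1 b : \sum_a k b a <= 1.
  rewrite (bigD1 b)//= {1}/k eqxx.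
  apply: (@le_trans _ _ (1 - del + \sum_(a | a != b) del / K)).
    by rewrite lerD2l; apply: ler_sum => a /negPf ab; rewrite /k ab.
  rewrite -lerBrDl opprB addrC subrK sumr_const -mulr_natl.
  rewrite mulrA ler_pdivrMr ?(K0 b)// mulrC ler_wpM2l ?ler_nat ?max_card//.
  exact: ltW.
pose g t z (x : {ffun 'I_n -> I}) := \prod_j k (F t z j) (x j).
have g0 t z x : 0 < g t z x by apply: prodr_gt0.
have g1 t z : \sum_x g t z x <= 1.
  rewrite /g -(bigA_distr_bigA (fun j a => k (F t z j) a)) /=.
  by apply: prodr_ile1 => j _; rewrite k1 andbT sumr_ge0// => a _; exact: ltW.
pose kappa z x := T.+1%:R^-1 * \sum_t g t z x.
have kappaE t z x : T.+1%:R^-1 * g t z x <= kappa z x.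
  rewrite ler_wpM2l ?invr_ge0// (bigD1 t)//= lerDl sumr_ge0// => s _.
  exact: ltW.
have kappag t z x : 0 < T.+1%:R^-1 * g t z x by rewrite mulr_gt0// invr_gt0.
have kappa0 z x : 0 < kappa z x by exact: lt_le_trans (kappag ord0 z x) _.
have := @entropy_le_code _ _ _ p0 p1 _ _ X Z kappa
  (fun z i => ltW (kappa0 z i)) _ (fun w _ => kappa0 (Z w) (X w)).
have kappa1 z : \sum_x kappa z x <= 1.
  rewrite -big_distrr /= ler_pdivrMl// mulr1 exchange_big /=.
  rewrite (le_trans (ler_sum _ (fun t _ => g1 t z)))//.
  by rewrite sumr_const card_ord.
move=> /(_ kappa1) H; apply: (le_trans H).
rewrite -addrA lerD2l -sumrN.
have cost w : - (p w * ln (kappa (Z w) (X w))) <=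
    p w * ln T.+1%:R + \sum_j (p w * (eta / 2) +
      (if X w j != F (tau w) (Z w) j then p w * `|ln (K / del)| else 0)).
  rewrite -mulrN.
  have -> : \sum_j (p w * (eta / 2) + (if X w j != F (tau w) (Z w) j
      then p w * `|ln (K / del)| else 0)) = p w * \sum_j ((eta / 2) +
      (if X w j != F (tau w) (Z w) j then `|ln (K / del)| else 0)).
    rewrite big_distrr /=; apply: eq_bigr => j _; rewrite mulrDr.
    by case: ifP; rewrite ?mulr0.
  rewrite -mulrDr ler_wpM2l// lerNl.
  apply: le_trans (_ : ln (T.+1%:R^-1 * g (tau w) (Z w) (X w)) <= _); last first.
    by rewrite ler_ln ?posrE// kappaE.
  rewrite [leRHS]lnM ?posrE ?invr_gt0// [in leRHS]lnV ?posrE// opprD lerD2l.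
  rewrite /g ln_prod; last by move=> j.
  rewrite -sumrN; apply: ler_sum => j _; rewrite /k.
  case: eqP => _ /=; first by rewrite lndel addr0.
  rewrite -[in leRHS]invf_div [in leRHS]lnV ?posrE ?divr_gt0 ?(K0 (X w j))//.
  by rewrite lerN2 (le_trans (ler_norm _))// lerDr ltW//; apply: divr_gt0.
apply: (le_trans (ler_sum _ (fun w _ => cost w))).
rewrite big_split /= -big_distrl /= p1 mul1r lerD2l exchange_big /=.
have -> : n%:R * eta = \sum_(j < n) eta.
  by rewrite sumr_const card_ord mulr_natl.
apply: ler_sum => j _; rewrite big_split /= -big_distrl /= p1 mul1r.
rewrite -big_mkcond /= -big_distrl /=.
rewrite [leRHS](splitr eta) lerD2l; apply: le_trans epsK.
by rewrite ler_wpM2r.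
Qed.

End Hamming.

(** * Finite-valued measurable maps *)

Section FiniteValuedMaps.
Variables (d : measure_display) (T : measurableType d) (R : realType).
Variable mu : probability T R.

Definition finite_measurable (I : finType) (W : T -> I) :=
  forall i, measurable (W @^-1` [set i]).

Definition law (I : finType) (W : T -> I) (i : I) : R :=
  fine (mu (W @^-1` [set i])).

Lemma fine_prob_ge0 (B : set T) : 0 <= fine (mu B).
Proof. exact: fine_ge0. Qed.

Lemma fine_probK (B : set T) : measurable B -> (fine (mu B))%:E = mu B.
Proof. by move=> mB; rewrite fineK// fin_num_measure. Qed.

Lemma fine_prob_le (B C : set T) : measurable B -> measurable C -> B `<=` C ->
  fine (mu B) <= fine (mu C).
Proof. by move=> mB mC BC; rewrite -lee_fin !fine_probK// le_measure ?inE. Qed.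

Lemma fine_probU (B C : set T) : measurable B -> measurable C ->
  fine (mu (B `|` C)) <= fine (mu B) + fine (mu C).
Proof.
move=> mB mC; rewrite -lee_fin EFinD !fine_probK//; last exact: measurableU.
exact: measureU2.
Qed.

Lemma fine_probC (B : set T) : measurable B -> fine (mu (~` B)) = 1 - fine (mu B).
Proof.
move=> mB; apply: EFin_inj; rewrite EFinB !fine_probK//; last exact: measurableC.
exact: probability_setC.
Qed.

Section OneMap.
Variables (I : finType) (W : T -> I).
Hypothesis mW : finite_measurable W.

Lemma finite_measurable_preimage (E : set I) : measurable (W @^-1` E).
Proof.
rewrite (_ : W @^-1` E = \bigcup_(i in E) (W @^-1` [set i])).
  by apply: fin_bigcup_measurable => //; exact: finite_finset.
by apply/seteqP; split => [x Ex|x [i Ei /= Wx]];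
    [exists (W x)|rewrite /preimage /= Wx].
Qed.

Lemma law_ge0 i : 0 <= law W i.
Proof. exact: fine_prob_ge0. Qed.

Lemma law_sum (Q : pred I) :
  \sum_(i | Q i) law W i = fine (mu (W @^-1` [set` Q])).
Proof.
rewrite (_ : W @^-1` _ = \bigcup_(i in [set` Q]) (W @^-1` [set i])); last first.
  by apply/seteqP; split => [x Ex|x [i Ei /= Wx]];
    [exists (W x)|rewrite /preimage /= Wx].
rewrite measure_fin_bigcup//; last by move=> i j _ _ [x [/= <- <-]].
rewrite -(@bigfs _ _ _ _ (index_enum I)) ?index_enum_uniq// => [|i _]; last first.
  by rewrite mem_index_enum.
apply: EFin_inj; rewrite fineK; last first.
  by apply/sum_fin_numP => i _ _; exact: fin_num_measure.
by rewrite -sumEFin; apply: eq_bigr => i _; rewrite fine_probK.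
Qed.

Lemma law_sum1 : \sum_i law W i = 1.
Proof.
rewrite law_sum (_ : _ @^-1` _ = setT) ?probability_setT//.
by apply/seteqP; split.
Qed.

Lemma law_of_law (J : finType) (f : I -> J) j :
  law_of (law W) f j = law (f \o W) j.
Proof.
rewrite /law_of law_sum /law; congr (fine (mu _)).
by apply/seteqP; split => x /= /eqP.
Qed.

Lemma partition_entropyE (J : finType) (f : I -> J) :
  partition_entropy mu (f \o W) = entropy_of (law W) f.
Proof.
by rewrite /entropy_of; congr (- _); apply: eq_bigr => j _; rewrite law_of_law.
Qed.

End OneMap.

Lemma finite_measurable_pair (I J : finType) (V : T -> I) (W : T -> J) :
  finite_measurable V -> finite_measurable W ->
  finite_measurable (fun x => (V x, W x)).
Proof.
move=> mV mW [i j].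
rewrite (_ : _ @^-1` _ = V @^-1` [set i] `&` W @^-1` [set j]).
  exact: measurableI.
by apply/seteqP; split => x /= => [[-> ->]|[-> ->]].
Qed.

Lemma finite_measurable_ffun (K I : finType) (V : K -> T -> I) :
  (forall k, finite_measurable (V k)) ->
  finite_measurable (fun x => [ffun k => V k x]).
Proof.
move=> mV f.
rewrite (_ : _ @^-1` _ = \bigcap_(k in [set: K]) V k @^-1` [set f k]).
  by apply: fin_bigcap_measurable => [|k _]; [exact: finite_finset|exact: mV].
apply/seteqP; split => [x /= /ffunP fx k _ /=|x fx /=].
  by have := fx k; rewrite ffunE.
by apply/ffunP => k; rewrite ffunE; exact: fx.
Qed.

Lemma partition_entropy_le (I J : finType) (W : T -> J) (f : J -> I) :
  finite_measurable W ->
  partition_entropy mu (f \o W) <= partition_entropy mu W.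
Proof.
move=> mW; rewrite (partition_entropyE mW f) -[W in leRHS]/(id \o W).
rewrite (partition_entropyE mW id); apply: entropy_of_factor.
  exact: law_ge0.
exact: law_sum1.
Qed.

Lemma partition_entropy_pair (I J : finType) (V : T -> I) (W : T -> J) :
  finite_measurable V -> finite_measurable W ->
  partition_entropy mu (fun x => (V x, W x)) <=
  partition_entropy mu V + partition_entropy mu W.
Proof.
move=> mV mW; have mVW := finite_measurable_pair mV mW.
have := entropy_of_pair (law_ge0 (fun x => (V x, W x))) (law_sum1 mVW) snd fst.
by rewrite -!partition_entropyE.
Qed.

Lemma partition_entropy_le_card (I : finType) (W : T -> I) (E : {set I}) :
  finite_measurable W -> (forall x, W x \in E) ->
  partition_entropy mu W <= ln #|E|%:R.
Proof.
move=> mW WE; rewrite -[W]/(id \o W) (partition_entropyE mW).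
apply: entropy_of_le_card => [i||i]; [exact: law_ge0|exact: law_sum1|].
apply: contraNT => iE; rewrite /law (_ : _ @^-1` _ = set0) ?measure0//.
by rewrite -subset0 => x /= Wx; move: iE; rewrite -Wx WE.
Qed.

End FiniteValuedMaps.

(** * Combinatorics of refilling *)

(** The least positive difference d of two elements divides every element, hence is the gcd of the
    semigroup. In the application [P] is the set of return lengths of a word, and d is the
    period. *)
Lemma large_multiples (P : nat -> Prop) :
  (forall a b, P a -> P b -> P (a + b)%N) -> (exists2 t, (0 < t)%N & P t) ->
  exists d N, (forall m, P m -> (d %| m)%N) /\
    (forall k, (N <= k)%N -> (d %| k)%N -> P k).
Proof.
move=> PD [t0 t0_gt0 Pt0].
pose Q d := `[< (0 < d)%N /\ exists2 t, P t & P (t + d)%N >].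
have exQ : exists d, Q d.
  by exists t0; apply/asboolP; split=> //; exists t0 => //; exact: PD.
case: (ex_minnP exQ) => d /asboolP [d0 [t Pt Ptd]] dmin.
have PM a n : (0 < n)%N -> P a -> P (a * n)%N.
  move=> n0 Pa; elim: n n0 => // -[|n] IH _; first by rewrite muln1.
  by rewrite mulnS; apply: PD => //; exact: IH.
have dP m : P m -> (d %| m)%N.
  move=> Pm; rewrite /dvdn -leqn0 leqNgt; apply/negP => r0.
  suff : (d <= m %% d)%N by rewrite leqNgt ltn_mod d0.
  apply: dmin; apply/asboolP; split=> //.
  have [q0|q0] := posnP (m %/ d).
    exists t => //; suff -> : (m %% d = m)%N by exact: PD.
    by rewrite [RHS](divn_eq m d) q0 mul0n.
  (* With q the quotient of m by d, adding the remainder to (t + d) q gives t q + m, again in P; so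
     the remainder is itself a difference of two elements. *)
  exists ((t + d) * (m %/ d))%N; first exact: PM.
  rewrite mulnDl -addnA [(d * _)%N]mulnC -divn_eq.
  by apply: PD => //; exact: PM.
exists d, (t * t.+1)%N; split=> // k Nk dk.
have dt : (d %| t)%N by exact: dP.
have [t00|t1] := posnP t.
  have Pd : P d by rewrite -[d]add0n -t00.
  have P0 : P 0%N by rewrite -t00.
  have [k0|k1] := posnP (k %/ d); first by rewrite -(divnK dk) k0.
  by rewrite -(divnK dk) mulnC; exact: PM.
have kt : (t.+1 <= k %/ t)%N by rewrite leq_divRL// mulnC.
have kE := divn_eq k t.
have dr : (d %| k %% t)%N by rewrite /dvdn modn_dvdm// -/(dvdn d k).
(* The remainder of k modulo t is d b with b < t, and is produced by using t + d instead of t for b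
   of the summands; k >= t (t+1) provides enough summands. *)
pose b := ((k %% t) %/ d)%N.
have bt : (b < t)%N by rewrite (leq_ltn_trans (leq_div _ _))// ltn_mod.
have -> : k = (t * (k %/ t - b) + (t + d) * b)%N.
  rewrite {1}kE mulnDl addnA -mulnDr subnK; last by lia.
  by rewrite [(d * b)%N]mulnC /b (divnK dr) [(t * _)%N]mulnC.
have [b0|b0] := posnP b.
  by rewrite b0 subn0 muln0 addn0; apply: PM => //; lia.
by apply: PD; apply: PM => //; lia.
Qed.

Section RefillWeight.
Variables (R : realType) (B : finType) (k : nat).
Variables (L : {set {ffun 'I_k -> B}}) (G D : {set B}).
Hypothesis LD : forall x i, x \in L -> x i \in D.
Hypothesis refill : forall x i, x \in L ->
  exists2 y, y \in L & (forall j, j != i -> y j = x j) /\ y i \in G.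

Let w (b : B) : R := if b \in G then 2^-1 else 1.

(** The sum will be the normalising constant of a trial distribution favouring tuples with few
    entries in [G]. Coordinates are treated one at a time: among the at most |D| tuples that agree
    off i, at least one has its entry in [G], and halving its weight removes 1/2 from a total of at
    most |D|. *)
Lemma refill_weight_seq (s : seq 'I_k) : uniq s ->
  \sum_(x in L) \prod_(i <- s) w (x i) <=
  #|L|%:R * (1 - (2 * #|D|%:R)^-1) ^+ size s.
Proof.
have w0 b : 0 < w b by rewrite /w; case: ifP => _; rewrite ?invr_gt0.
elim: s => [_|i s IH /= /andP[is_ us]].
  rewrite expr0 mulr1; under eq_bigr do rewrite big_nil.
  by rewrite sumr_const.
(* [e] erases coordinate i, so its fibres are the families of tuples that differ only there. *)
pose e (x : {ffun 'I_k -> B}) : {ffun 'I_k -> option B} :=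
  [ffun j => if j == i then None else Some (x j)].
have D0 : 0 <= (2 * #|D|%:R)^-1 :> R by rewrite invr_ge0 mulr_ge0.
have D1 : (2 * #|D|%:R)^-1 <= 1 :> R.
  have [->|D_gt0] := posnP #|D|; first by rewrite mulr0 invr0.
  rewrite invf_le1 ?mulr_gt0 ?ltr0n//.
  by rewrite -natrM ler1n; lia.
rewrite exprS mulrCA.
apply: le_trans (ler_wpM2l _ (IH us)); last by rewrite subr_ge0.
rewrite (partition_big e xpredT)//= [X in _ * X](partition_big e xpredT)//=.
rewrite big_distrr /=; apply: ler_sum => c _.
have [[x0 x0L ex0]|nofib] := pselect (exists2 x, x \in L & e x = c); last first.
  by rewrite !big1 ?mulr0// => x /andP[xL /eqP ex]; case: nofib; exists x.
have esame x j : e x = c -> j != i -> x j = x0 j.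
  move=> exc ji; have : e x j = e x0 j by rewrite exc ex0.
  by rewrite !ffunE (negPf ji) => -[].
pose W := \prod_(j <- s) w (x0 j).
have WE x : e x = c -> \prod_(j <- s) w (x j) = W.
  move=> exc; apply: eq_big_seq => j js; rewrite (esame x)//.
  by apply: contraNneq is_ => <-.
pose F := [set x in L | e x == c].
have FE (g : {ffun 'I_k -> B} -> R) :
    \sum_(x in L | e x == c) g x = \sum_(x in F) g x.
  by apply: eq_bigl => x; rewrite !inE.
rewrite (eq_bigr (fun x : {ffun _} => w (x i) * W)); last first.
  by move=> x /andP[_ /eqP exc]; rewrite big_cons WE.
rewrite [X in _ <= _ * X](eq_bigr (fun=> W)); last first.
  by move=> x /andP[_ /eqP exc]; rewrite WE.
rewrite !FE -big_distrl /= [X in _ <= _ * X]sumr_const -[X in _ <= _ * X]mulr_natl mulrA.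
apply: ler_wpM2r; first by apply/ltW/prodr_gt0.
have [y yL [yx yG]] := refill i x0L.
have yF : y \in F.
  rewrite !inE yL -ex0; apply/eqP/ffunP => j; rewrite !ffunE.
  by case: eqP => // /eqP /yx ->.
have FD : (#|F| <= #|D|)%N.
  rewrite -(@card_in_imset _ _ (fun x : {ffun 'I_k -> B} => x i) F).
    apply/subset_leq_card/fintype.subsetP => b /imsetP[x].
    by rewrite inE => /andP[xL _] ->; exact: LD.
  move=> x x'; rewrite !inE => /andP[_ /eqP xc] /andP[_ /eqP x'c] xx'.
  apply/ffunP => j; have [->//|ji] := eqVneq j i.
  by rewrite (esame x)// (esame x').
apply: (@le_trans _ _ (#|F|%:R - 2^-1)).
  rewrite (bigD1 y)//= {1}/w yG.
  have -> : #|F|%:R = \sum_(x in F) 1 :> R by rewrite sumr_const.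
  rewrite [in leRHS](bigD1 y)//= addrAC lerD//; first lra.
  apply: ler_sum => x _; rewrite /w; case: ifP => // _; lra.
have F0 : (0 < #|F|)%N by apply/card_gt0P; exists y.
rewrite mulrBl mul1r lerB// invfM -mulrA ler_piMr//.
by rewrite ler_pdivrMl ?ltr0n ?mulr1 ?ler_nat// (leq_trans F0).
Qed.

Lemma refill_weight :
  \sum_(x in L) \prod_i w (x i) <= #|L|%:R * (1 - (2 * #|D|%:R)^-1) ^+ k.
Proof.
have := @refill_weight_seq (enum 'I_k) (enum_uniq _); rewrite size_enum_ord.
by under eq_bigr do rewrite big_enum.
Qed.

End RefillWeight.

(** * Words of a subshift of finite type *)

Section Language.
Variables (A : finType) (X : subshift A).
Implicit Types (x y z : points X) (j p q : int) (n m k : nat).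

Definition at_ x (j : int) : A := seq_of x j.

Definition word n (j : int) x : {ffun 'I_n -> A} := [ffun i : 'I_n => at_ x (j + i%:Z)].

Definition lang n : {set {ffun 'I_n -> A}} :=
  [set w | `[< exists x, word n 0 x = w >]].

Lemma points_eq x y : at_ x =1 at_ y -> x = y.
Proof. by move=> xy; apply: val_inj; apply: funext => j; exact: xy. Qed.

Lemma at_sigma x j : at_ (sigma x) j = at_ x (j + 1).
Proof. by []. Qed.

Lemma at_iter_sigma k x j : at_ (iter k (@sigma A X) x) j = at_ x (j + k%:Z).
Proof.
elim: k j => [|k IH] j; first by rewrite addr0.
by rewrite iterS at_sigma IH; congr at_; lia.
Qed.

(** Negative translations come from sigma being onto X, one preimage at a time. *)
Lemma translate (c : int) x : exists y, forall j, at_ y j = at_ x (j + c).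
Proof.
case: c => c; first by exists (iter c (@sigma A X) x) => j; rewrite at_iter_sigma.
have back y : exists z, forall j, at_ z j = at_ y (j - 1).
  have : (subshift_set X) (seq_of y) by exact: set_valP.
  rewrite -[S in S _](subshift_invariant X) => -[z Xz zy].
  exists (SigSub (mem_set Xz)) => j.
  rewrite /at_ -[in RHS]zy /shift/=; congr z; lia.
have {}back n : exists z, forall j, at_ z j = at_ x (j - n%:Z).
  elim: n => [|n [z zP]]; first by exists x => j; rewrite subr0.
  have [z' z'P] := back z; exists z' => j.
  by rewrite z'P zP; congr at_; lia.
by have [z zP] := back c.+1; exists z => j; rewrite zP NegzE.
Qed.

Lemma word_eqP n p q x y :
  word n p x = word n q y <->
  (forall i : nat, (i < n)%N -> at_ x (p + i%:Z) = at_ y (q + i%:Z)).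
Proof.
split=> [/ffunP xy i ilt|xy]; first by have := xy (Ordinal ilt); rewrite !ffunE.
by apply/ffunP => i; rewrite !ffunE; exact: xy.
Qed.

Lemma word_in_lang n j x : word n j x \in lang n.
Proof.
rewrite inE; apply/asboolP; have [y yP] := translate j x; exists y.
by apply/word_eqP => i _; rewrite yP; congr at_; lia.
Qed.

Lemma langP n (w : {ffun 'I_n -> A}) :
  reflect (exists x, word n 0 x = w) (w \in lang n).
Proof. by rewrite inE; exact: asboolP. Qed.

Lemma lang_point n (w : {ffun 'I_n -> A}) j :
  w \in lang n -> exists x, word n j x = w.
Proof.
move=> /langP[x <-]; have [y yP] := translate (- j) x; exists y.
by apply/word_eqP => i _; rewrite yP; congr at_; lia.
Qed.

Lemma card_lang_gt0 n : (0 < #|lang n|)%N.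
Proof. by apply/card_gt0P; exists (word n 0 point); exact: word_in_lang. Qed.

(** The default letter makes the function total; it is not read when k + m <= n. *)
Definition subword n m k (w : {ffun 'I_n -> A}) : {ffun 'I_m -> A} :=
  [ffun i : 'I_m => if insub (k + i)%N is Some l then w l else at_ point 0].

Lemma subword_word n m k j x : (k + m <= n)%N ->
  subword m k (word n j x) = word m (j + k%:Z) x.
Proof.
move=> kmn; apply/ffunP => i; rewrite !ffunE.
have lt_n : (k + i < n)%N by rewrite (leq_trans _ kmn)// ltn_add2l.
by rewrite insubT ffunE /=; congr at_; lia.
Qed.

Lemma word_determines n m k i j x y : (k + m <= n)%N ->
  word n i x = word n j y -> word m (i + k%:Z) x = word m (j + k%:Z) y.
Proof. by move=> kmn xy; rewrite -!(@subword_word n) ?xy. Qed.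

Lemma lang_submul n m : (#|lang (n + m)| <= #|lang n| * #|lang m|)%N.
Proof.
pose f (w : {ffun 'I_(n + m) -> A}) := (subword n 0 w, subword m n w).
have finj : {in lang (n + m) &, injective f}.
  move=> _ _ /langP[x <-] /langP[y <-].
  rewrite /f !subword_word ?leq_addr// => -[/word_eqP e1 /word_eqP e2].
  apply/word_eqP => i ilt; have [lt|ge] := ltnP i n.
    by have := e1 _ lt; rewrite !addr0.
  have := e2 (i - n)%N; have -> : 0 + n%:Z + (i - n)%N%:Z = 0 + i%:Z by lia.
  by apply; lia.
rewrite -cardsX -(card_in_imset finj).
apply/subset_leq_card/fintype.subsetP => _ /imsetP[_ /langP[x <-] ->].
by rewrite finset.in_setX /f !subword_word ?leq_addr// !word_in_lang.
Qed.

Lemma card_lang_le n : (#|lang n| <= #|A| ^ n)%N.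
Proof. by rewrite (leq_trans (max_card _))// card_ffun card_ord. Qed.

Lemma card_langD_le n m : (#|lang (n + m)| <= #|lang n| * #|A| ^ m)%N.
Proof. by rewrite (leq_trans (lang_submul n m))// leq_mul2l card_lang_le orbT. Qed.

Hypothesis sftX : is_SFT X.
Hypothesis irrX : irreducible X.

Lemma size_word_at (x : fullshift A) j k : size (word_at x j k) = k.
Proof. by rewrite size_map size_iota. Qed.

Lemma eq_word_at (x y : fullshift A) p q k :
  (forall i : nat, (i < k)%N -> x (p + i%:Z) = y (q + i%:Z)) ->
  word_at x p k = word_at y q k.
Proof.
by move=> xy; apply/eq_in_map => i; rewrite mem_iota => /andP[_]; exact: xy.
Qed.

(** With s the greatest length of a forbidden word, an occurrence in the glued sequence either ends
    by p + s, inside x, or starts after p, inside the translate of y; the overlap of s letters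
    leaves no third case. *)
Lemma SFT_glue : exists s : nat, forall x y p q, word s p x = word s q y ->
  exists z, (forall j, (j < p + s%:Z)%R -> at_ z j = at_ x j) /\
            (forall j, (p <= j)%R -> at_ z j = at_ y (j - p + q)).
Proof.
have [F FE] := sftX; exists (\max_(w <- F) size w)%N.
set s := (\max_(w <- F) size w)%N => x y p q /word_eqP xy.
pose z : fullshift A := fun j => if j < p + s%:Z then at_ x j else at_ y (j - p + q).
have zy j : p <= j -> z j = at_ y (j - p + q).
  rewrite /z; case: ifP => // lt le.
  have := xy `|j - p|%N; rewrite (_ : p + `|j - p|%N = j); last by lia.
  by rewrite (_ : q + `|j - p|%N = j - p + q); [apply; lia|lia].
have sub w : (subshift_set X) w -> forall v, v \in F -> ~ occurs v w by rewrite FE.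
have Xz : (subshift_set X) z.
  rewrite FE => v vF [j jv].
  have vs : (size v <= s)%N by exact: leq_bigmax_seq.
  move: (size v) vs jv => k ks jv.
  have [le|gt] := leP (j + k%:Z) (p + s%:Z).
    apply: (sub _ (set_valP x) _ vF); exists j; rewrite -jv size_word_at.
    by apply: eq_word_at => i ilt; rewrite /z (_ : j + i%:Z < p + s%:Z)//; lia.
  apply: (sub _ (set_valP y) _ vF); exists (j - p + q); rewrite -jv size_word_at.
  by apply: eq_word_at => i ilt; rewrite zy; [congr (seq_of y); lia|lia].
exists (SigSub (mem_set Xz)); split => j jp; last exact: zy.
by rewrite /at_ /seq_of /= /z jp.
Qed.

(** These are the paths of length m in the graph of s-words. The length is the offset between the
    starts, so the two words overlap when m < s. *)
Definition linked s (u v : {ffun 'I_s -> A}) m :=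
  exists x, word s 0 x = u /\ word s m%:Z x = v.

Lemma linked_word s x p q m : q = p + m%:Z ->
  linked (word s p x) (word s q x) m.
Proof.
move=> ->; have [y yP] := translate p x; exists y.
by split; apply/word_eqP => i _; rewrite yP; congr at_; lia.
Qed.

Lemma linked_trans s : (forall x y p q, word s p x = word s q y ->
  exists z, (forall j, (j < p + s%:Z)%R -> at_ z j = at_ x j) /\
            (forall j, (p <= j)%R -> at_ z j = at_ y (j - p + q))) ->
  forall u v w m k, linked u v m -> @linked s v w k -> linked u w (m + k).
Proof.
move=> glue u v w m k [x [<- xm]] [y [y0 <-]].
have [z [zx zy]] := glue x y m%:Z 0 (etrans xm (esym y0)).
exists z; split; apply/word_eqP => i ilt; first by apply: zx; lia.
by rewrite zy; [congr at_; lia|lia].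
Qed.

Lemma irreducible_linked s u v : u \in lang s -> v \in lang s ->
  exists2 m, (0 < m)%N & @linked s u v m.
Proof.
move=> /langP[x <-] /langP[y <-].
have cyl z : (cylinder 0 (word_at (seq_of z) 0 s)) z.
  by rewrite /cylinder /= size_map size_iota.
have cylE z w : (cylinder 0 (word_at (seq_of z) 0 s)) w -> word s 0 w = word s 0 z.
  rewrite /cylinder /= size_map size_iota => /eq_in_map e.
  by apply/word_eqP => i ilt; apply: e; rewrite mem_iota.
have [k k1 [w [[z zx zw] wy]]] := irrX (ex_intro _ x (cyl x)) (ex_intro _ y (cyl y)).
exists k => //; exists z; split; first exact: cylE.
rewrite -(cylE _ _ wy) -zw; apply/word_eqP => i _.
by rewrite at_iter_sigma; congr at_; lia.
Qed.

Lemma linked_bound s : exists K, forall u v, u \in lang s -> v \in lang s ->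
  exists2 m, (m <= K)%N & @linked s u v m.
Proof.
have /choice[f fP] (uv : {ffun 'I_s -> A} * {ffun 'I_s -> A}) :
  exists m, uv.1 \in lang s -> uv.2 \in lang s -> linked uv.1 uv.2 m.
  have [[u1 v1]|h] := pselect (uv.1 \in lang s /\ uv.2 \in lang s); last first.
    by exists 0%N => u1 v1; case: h.
  by have [m _ mP] := irreducible_linked u1 v1; exists m.
exists (\max_uv f uv)%N => u v ul vl; exists (f (u, v)); last exact: (fP (u, v)).
exact: leq_bigmax.
Qed.

(** A pair of words is read off one word of length n + m + K once the offset of the second is known.
    Hence C: K+1 offsets, times |A|^K for the K additional letters. *)
Lemma lang_supmul : exists2 C, (0 < C)%N &
  forall n m, (#|lang n| * #|lang m| <= C * #|lang (n + m)|)%N.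
Proof.
have [s glue] := SFT_glue; have [K Kp] := linked_bound s.
exists (K.+1 * #|A| ^ K)%N => [|n m].
  rewrite muln_gt0 expn_gt0; apply/orP; left; apply/card_gt0P.
  by exists (at_ point 0).
pose f (lw : 'I_K.+1 * {ffun 'I_(n + m + K) -> A}) :=
  (subword n 0 lw.2, subword m (n + lw.1) lw.2).
rewrite -cardsX.
suff sub : finset.setX (lang n) (lang m) \subset
    f @: (finset.setX [set: 'I_K.+1] (lang (n + m + K))).
  rewrite (leq_trans (subset_leq_card sub))// (leq_trans (leq_imset_card _ _))//.
  rewrite cardsX cardsT card_ord -mulnA leq_mul2l [(_ * #|lang (n + m)|)%N]mulnC.
  by rewrite card_langD_le orbT.
apply/fintype.subsetP => -[u v] /finset.setXP[/= /langP[x <-] /langP[y <-]].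
have [l lK [z [z0 zl]]] := Kp _ _ (word_in_lang s n%:Z x) (word_in_lang s 0 y).
have [t [tx tz]] := glue x z n%:Z 0 (esym z0).
have tl : word s (n%:Z + l%:Z) t = word s 0 y.
  by rewrite -zl; apply/word_eqP => i _; rewrite tz; [congr at_; lia|lia].
have [r [rt ry]] := glue t y _ _ tl.
apply/imsetP; exists (inord l, word (n + m + K) 0 r).
  by rewrite inE inE word_in_lang.
rewrite /f /= inordK// !subword_word; [|lia|lia].
congr pair; apply/word_eqP => i ilt.
  by rewrite rt; [rewrite tx; [congr at_; lia|lia]|lia].
by rewrite ry; [congr at_; lia|lia].
Qed.

(* The connecting lengths are adjusted modulo the period of the SFT, so that
   a window of prescribed length can be refilled without moving its surroundings. *)
Lemma window_refill : exists K, forall n (a : {ffun 'I_n -> A}), a \in lang n ->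
  forall x j, exists y t, [/\ (t <= K)%N,
    (forall i, (i < j) || (j + (n + K)%N%:Z <= i) -> at_ y i = at_ x i) &
    word n (j + t%:Z) y = a].
Proof.
have [s glue] := SFT_glue; have [K1 K1p] := linked_bound s.
have lt := linked_trans glue.
pose o := word s 0 point; have ol : o \in lang s by exact: word_in_lang.
have [||d [K0 [dR R0]]] := @large_multiples (linked o o).
- by move=> a b; exact: lt.
- by have [m m0 mP] := irreducible_linked ol ol; exists m.
(* The route is u, o, o, the inserted word, o, v. Four connections take at most K1 each, the loop at
   o needs length at least K0 to be available, and s is the length of v. *)
exists (s + K0 + 4 * K1)%N => n _ /langP[z <-] x j.
pose m := (n + K0 + 4 * K1)%N.
pose u := word s j x; pose v := word s (j + m%:Z) x.
have uv : linked u v m by exact: linked_word.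
have zz : linked (word s 0 z) (word s n%:Z z) n by apply: linked_word; rewrite add0r.
have ul : u \in lang s by exact: word_in_lang.
have vl : v \in lang s by exact: word_in_lang.
have z0l := word_in_lang s 0 z; have zl := word_in_lang s n%:Z z.
have [al alK alP] := K1p _ _ ul ol; have [be beK beP] := K1p _ _ ol z0l.
have [ga gaK gaP] := K1p _ _ zl ol; have [de deK deP] := K1p _ _ ol vl.
have [m1 _ m1P] := K1p _ _ ol ul; have [m2 _ m2P] := K1p _ _ vl ol.
pose k := (m - (al + be + n + ga + de))%N.
have Rk : linked o o k.
  apply: R0; first by rewrite /k /m; lia.
  (* Closing up at o both the route through x, of length m, and the route through the inserted word
     gives two return lengths. Both are multiples of d, hence so is their difference k. *)
  have d1 := dR _ (lt _ _ _ _ _ (lt _ _ _ _ _ m1P uv) m2P).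
  have d2 := dR _ (lt _ _ _ _ _ (lt _ _ _ _ _ m1P (lt _ _ _ _ _
    (lt _ _ _ _ _ (lt _ _ _ _ _ (lt _ _ _ _ _ alP beP) zz) gaP) deP)) m2P).
  rewrite -(dvdn_addl _ d2).
  by rewrite (_ : (_ + _)%N = (m1 + m + m2)%N)//; rewrite /k /m; lia.
pose l1 := (al + k + be)%N; pose l2 := (ga + de)%N.
have [c1 [c10 c1l]] : linked u (word s 0 z) l1.
  exact: lt (lt _ _ _ _ _ alP Rk) beP.
have [c2 [c20 c2l]] : linked (word s n%:Z z) v l2 by exact: lt deP.
have mE : m = (l1 + n + l2)%N by rewrite /l1 /l2 /k /m; lia.
have [y1 [y1x y1c]] := glue x c1 j 0 (esym c10).
have e1 : word s (j + l1%:Z) y1 = word s 0 z.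
  by rewrite -c1l; apply/word_eqP => i _; rewrite y1c; [congr at_; lia|lia].
have [y2 [y2y y2z]] := glue _ _ _ _ e1.
have e2 : word s (j + l1%:Z + n%:Z) y2 = word s 0 c2.
  by rewrite c20; apply/word_eqP => i _; rewrite y2z; [congr at_; lia|lia].
have [y3 [y3y y3c]] := glue _ _ _ _ e2.
have e3 : word s (j + m%:Z) y3 = word s (j + m%:Z) x.
  rewrite -[RHS]c2l; apply/word_eqP => i _.
  by rewrite y3c; [congr at_; lia|lia].
have [y4 [y4y y4x]] := glue _ _ _ _ e3.
exists y4, l1; split.
- by rewrite /l1; move: mE; rewrite /l1 /l2 /m; lia.
- move=> i /orP[ij|ij].
    rewrite y4y; last by lia.
    rewrite y3y; last by lia.
    rewrite y2y; last by lia.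
    by rewrite y1x//; lia.
  by rewrite y4x; [congr at_; lia|rewrite /m; lia].
- apply/word_eqP => i ilt.
  rewrite y4y; last by lia.
  rewrite y3y; last by lia.
  by rewrite y2z; [congr at_; lia|lia].
Qed.

End Language.

(** * Topology of a subshift *)

Section Topology.
Variables (A : finType) (X : subshift A).
Implicit Types (x y z : points X) (U : set (points X)).

Lemma nbhs_fullshift (f : fullshift A) (U : set (fullshift A)) : nbhs f U ->
  exists m, forall g : fullshift A, agree_on_window m g f -> U g.
Proof.
pose F : set_system (fullshift A) :=
  filter_from setT (fun m => [set g : fullshift A | agree_on_window m g f]).
have FF : Filter F.
  apply: filter_from_filter; first by exists 0%N.
  move=> m n _ _; exists (maxn m n) => // g gf.
  by split=> j jm; apply: gf; lia.
have : F --> f.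
  apply/cvg_sup => j V; rewrite nbhsE => -[W [[B _ BW] Wf] WV].
  exists `|j|%N => // g gf; apply: WV; rewrite -BW /=.
  by rewrite gf; [rewrite -BW in Wf|lia].
by move=> /[apply] -[m _ mU]; exists m.
Qed.

Lemma open_eval (j : int) (a : A) : open [set f : fullshift A | f j = a].
Proof.
rewrite (_ : [set f | _] =
  (@proj int (fun _ => discrete_topology A) j) @^-1` [set a]) //.
apply: open_comp; last exact: discrete_open.
by move=> f _; exact: proj_continuous.
Qed.

Lemma open_at (j : int) (a : A) : open [set x : points X | at_ x j = a].
Proof. by exists [set f : fullshift A | f j = a]; [exact: open_eval|]. Qed.

Lemma open_ball_window m x : open (ball_window m x).
Proof.
rewrite (_ : ball_window m x = \bigcap_(i in `I_(m.*2.+1))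
   [set y | at_ y (i%:Z - m%:Z) = at_ x (i%:Z - m%:Z)]).
  rewrite bigcap_mkord; apply: big_ind => [|B C|i _];
    [exact: openT|exact: openI|exact: open_at].
apply/seteqP; split=> y yx.
  by move=> i /= im; apply: yx; lia.
move=> j jm; have := yx `|(j + m%:Z)%R|%N.
rewrite /at_ /= (_ : (`|(j + m%:Z)%R|%N)%:Z - m%:Z = j); last by lia.
by apply; lia.
Qed.

Lemma open_window U x : open U -> U x -> exists m, ball_window m x `<=` U.
Proof.
move=> [V oV VU] Ux; have Vx : V (seq_of x) by rewrite -VU in Ux.
have [m mV] := nbhs_fullshift (open_nbhs_nbhs (conj oV Vx)).
by exists m => y yx; rewrite -VU; exact: mV.
Qed.

(** Such sets are unions of cylinders over [-m, m], hence clopen; they are the finite-level sets on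
    which measures are compared with word counts. *)
Definition window_set m U := forall x y, ball_window m x y -> U x -> U y.

Lemma ball_windowC m x y : ball_window m x y -> ball_window m y x.
Proof. by move=> xy j jm; rewrite xy. Qed.

Lemma ball_window_trans m x y z :
  ball_window m x y -> ball_window m y z -> ball_window m x z.
Proof. by move=> xy yz j jm; rewrite yz// xy. Qed.

Lemma window_set_open m U : window_set m U -> open U.
Proof.
move=> mU; rewrite openE => x Ux.
apply: (filterS (P := ball_window m x)) => [y yx|]; first exact: mU yx Ux.
by apply: open_nbhs_nbhs; split; [exact: open_ball_window|].
Qed.

Lemma window_setC m U : window_set m U -> window_set m (~` U).
Proof. by move=> mU x y xy Ux Uy; apply: Ux; exact: mU (ball_windowC xy) Uy. Qed.

Lemma window_set_le m n U : (m <= n)%N -> window_set m U -> window_set n U.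
Proof. by move=> mn mU x y xy; apply: mU => j jm; apply: xy; lia. Qed.

Definition window_core m U := [set x | ball_window m x `<=` U].

Lemma window_core_window m U : window_set m (window_core m U).
Proof. by move=> x y xy xU z yz; apply: xU; exact: ball_window_trans yz. Qed.

Lemma window_core_mono U : {homo window_core ^~ U : m n / (m <= n)%N >-> m `<=` n}.
Proof. by move=> m n mn x xU y xy; apply: xU => j jm; apply: xy; lia. Qed.

Lemma bigcup_window_core U : open U -> \bigcup_m window_core m U = U.
Proof.
move=> oU; apply/seteqP; split=> [x [m _]|x Ux]; first by apply.
by have [m mU] := open_window oU Ux; exists m.
Qed.

Lemma compact_points : compact [set: points X].
Proof.
have cS : compact (subshift_set X).
  apply: (subclosed_compact (B := setT)) => //; first exact: subshift_closed.
  have := @tychonoff int (fun=> discrete_topology A) (fun=> setT).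
  rewrite (_ : [set f | _] = setT); last by apply/seteqP; split.
  apply=> i; apply: finite_compact; exact: finite_finset.
move=> F PF _.
have [|f [Xf clf]] := cS (@seq_of A X @ F) _.
  have FX : F (@seq_of A X @^-1` subshift_set X).
    by apply: filterS filterT => x _; exact: set_valP.
  exact: FX.
exists (SigSub (mem_set Xf)); split=> // B V FB.
rewrite nbhsE => -[W [[C oC CW] Wf] WV].
have [||g [[x Bx xg] Cg]] := clf (@seq_of A X @` B) C.
- suff : F (@seq_of A X @^-1` (@seq_of A X @` B)) by [].
  by apply: filterS FB => x Bx; exists x.
- by apply: open_nbhs_nbhs; split=> //; rewrite -CW in Wf.
by exists x; split=> //; apply: WV; rewrite -CW; move: Cg; rewrite -xg.
Qed.

Lemma compact_increasing (U : nat -> set (points X)) :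
  (forall m, open (U m)) -> {homo U : m n / (m <= n)%N >-> m `<=` n} ->
  (forall x, exists m, U m x) -> exists m, forall x, U m x.
Proof.
move=> oU Umono covU; have := compact_points; rewrite compact_cover => /(_ _ setT U).
move=> [m _ //|x _|D _ covD].
  by have [m Um] := covU x; exists m.
exists (\max_(m <- finmap.enum_fset D) m)%N => x; have [m /= mD Um] := covD x I.
by apply: Umono Um; exact: (leq_bigmax_seq (F := id)).
Qed.

(** * The local rule of a cellular automaton and the closedness of its image *)

Section CellularAutomaton.
Variable phi : points X -> points X.
Hypothesis CAphi : cellular_automaton phi.

Lemma CA_sigma_iter k x : phi (iter k (@sigma A X) x) = iter k (@sigma A X) (phi x).
Proof. by elim: k => //= k IH; rewrite CAphi.2 IH. Qed.

(** This is the Curtis-Hedlund-Lyndon theorem: compactness gives one radius for coordinate 0, and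
    commutation with sigma carries it to every pair of positions. *)
Lemma CA_radius : exists r : nat, forall x y (i j : int),
  (forall k : int, `|k| <= r%:Z -> at_ x (i + k) = at_ y (j + k)) ->
  at_ (phi x) i = at_ (phi y) j.
Proof.
have [cphi _] := CAphi.
pose V x := [set y | at_ (phi y) 0 = at_ (phi x) 0].
have oV x : open (V x).
  by move/continuousP: cphi => /(_ _ (open_at 0 (at_ (phi x) 0))).
have [||x|r rP] := @compact_increasing (fun m => [set x | ball_window m x `<=` V x]).
- move=> m; apply: (@window_set_open m) => x y xy xV z yz.
  by rewrite /V /= (xV y xy) (xV z (ball_window_trans xy yz)).
- by move=> m n mn x xV y xy; apply: xV => j jm; apply: xy; lia.
- by have [m mV] := open_window (oV x) (erefl _ : V x x); exists m.
(* For a negative c the roles are exchanged: x is then an iterated sigma-image of x'. *)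
have phi_tr c x x' : (forall j, at_ x' j = at_ x (j + c)) ->
    forall j, at_ (phi x') j = at_ (phi x) (j + c).
  case: c => c x'x.
    have -> : x' = iter c (@sigma A X) x.
      by apply: points_eq => j; rewrite at_iter_sigma x'x.
    by move=> j; rewrite CA_sigma_iter at_iter_sigma.
  have -> : x = iter c.+1 (@sigma A X) x'.
    by apply: points_eq => j; rewrite at_iter_sigma x'x; congr at_; lia.
  by move=> j; rewrite CA_sigma_iter at_iter_sigma; congr at_; lia.
exists r => x y i j xy.
have [x' x'x] := translate i x; have [y' y'y] := translate j y.
have := phi_tr _ _ _ x'x 0; rewrite add0r => <-.
have := phi_tr _ _ _ y'y 0; rewrite add0r => <-.
apply: rP => k kr; rewrite -/(at_ x' k) -/(at_ y' k) x'x y'y.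
by rewrite addrC [_ + j]addrC; exact: xy.
Qed.

(** If y is not an image, every phi x leaves some window around y, and by compactness one window
    serves all x. *)
Lemma CA_not_surjective_window : ~ set_surj [set: points X] [set: points X] phi ->
  exists y m, forall x, ~ ball_window m y (phi x).
Proof.
move=> /existsNP[y /not_implyP[_ yphi]]; exists y.
have [cphi _] := CAphi.
have [||x|m mP] := @compact_increasing (fun m => phi @^-1` (~` ball_window m y)).
- move=> m; move/continuousP: cphi => /(_ (~` ball_window m y)); apply.
  apply: (@window_set_open m); apply: window_setC => x z xz yx.
  exact: ball_window_trans xz.
- by move=> m n mn x xm xn; apply: xm => j jm; apply: xn; lia.
- apply: contra_notP yphi => H; exists x => //; apply: points_eq => j.
  apply: contrapT => xyj; apply: H; exists `|j|%N => /= xy.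
  by apply: xyj; apply: xy; lia.
by exists m.
Qed.

End CellularAutomaton.
End Topology.

(** * Approximation of Borel sets *)

Section Borel.
Variable T : ptopologicalType.

Lemma borel_open (U : set T) : open U -> measurable (U : set (borel T)).
Proof. by move=> oU; exact: sub_sigma_algebra. Qed.

Lemma borel_ind (P : set (borel T) -> Prop) :
  (forall U : set T, open U -> P U) ->
  (forall B, measurable B -> P B -> P (~` B)) ->
  (forall F : nat -> set (borel T), (forall n, measurable (F n)) ->
    (forall n, P (F n)) -> P (\bigcup_n F n)) ->
  forall B : set (borel T), measurable B -> P B.
Proof.
move=> Po Pc Pu B mB.
suff [] : measurable B /\ P B by [].
apply: (smallest_sub (C := sigma_algebra setT) _ _ mB
  : [set C : set (borel T) | measurable C /\ P C] B).
  split=> [|C [mC PC]|F FP].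
  - by split; [exact: measurable0|apply: Po; exact: open0].
  - by rewrite setTD; split; [exact: measurableC|exact: Pc].
  - split; first by apply: bigcupT_measurable => n; exact: (FP n).1.
    by apply: Pu => n; have [] := FP n.
by move=> U oU; split; [exact: borel_open|exact: Po].
Qed.

Lemma continuous_preimage_borel (f : T -> T) (B : set (borel T)) :
  continuous f -> measurable B -> measurable (f @^-1` B : set (borel T)).
Proof.
move=> /continuousP cf; elim/borel_ind => [U oU|C mC mfC|F mF mfF].
- by apply: borel_open; exact: cf.
- by rewrite preimage_setC; exact: measurableC.
- by rewrite preimage_bigcup; exact: bigcupT_measurable.
Qed.

End Borel.

Definition setdiff_sym {T} (B E : set T) := (B `\` E) `|` (E `\` B).

Section ProbabilityLimits.
Variables (d : measure_display) (T : measurableType d) (R : realType).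
Variable mu : probability T R.

Lemma increasing_limit (F : nat -> set T) (eps : R) :
  (forall n, measurable (F n)) -> {homo F : m n / (m <= n)%N >-> m `<=` n} ->
  0 < eps -> exists N, forall n, (N <= n)%N ->
    fine (mu (\bigcup_n F n `\` F n)) <= eps.
Proof.
move=> mF Fmono eps0.
have mU : measurable (\bigcup_n F n) by exact: bigcupT_measurable.
have Fnd : {homo F : m n / (m <= n)%N >-> (m <= n)%O}.
  by move=> m n mn; apply/subsetPset; exact: Fmono.
have cvF : fine (mu (F n)) @[n --> \oo] --> fine (mu (\bigcup_n F n)).
  apply: fine_cvg; rewrite fine_probK//.
  exact: (nondecreasing_cvg_mu mF mU Fnd).
have [N _ NP] := (cvgrPdist_le _ _).1 cvF eps eps0.
exists N => n Nn; have := NP n Nn.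
have -> : fine (mu (\bigcup_n F n `\` F n)) =
    fine (mu (\bigcup_n F n)) - fine (mu (F n)).
  apply: EFin_inj; rewrite EFinB !fine_probK//; last exact: measurableD.
  rewrite measureD//; last by rewrite ltey_eq fin_num_measure.
  by rewrite setIidr//; exact: bigcup_sup.
by apply: le_trans; exact: ler_norm.
Qed.

End ProbabilityLimits.

Lemma increasing_limit_pair (d : measure_display) (T : measurableType d)
    (R : realType) (nu : bool -> probability T R) (F : nat -> set T) (eps : R) :
  (forall n, measurable (F n)) -> {homo F : m n / (m <= n)%N >-> m `<=` n} ->
  0 < eps -> exists N, forall b, fine (nu b (\bigcup_n F n `\` F N)) <= eps.
Proof.
move=> mF Fmono eps0.
have [N1 P1] := increasing_limit (nu true) mF Fmono eps0.
have [N2 P2] := increasing_limit (nu false) mF Fmono eps0.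
by exists (maxn N1 N2) => -[]; [apply: P1; rewrite leq_maxl|
  apply: P2; rewrite leq_maxr].
Qed.

Section Approximation.
Variables (A : finType) (X : subshift A) (R : realType).
Notation pointsB := (borel (points X)).

Lemma window_set_measurable m (U : set (points X)) :
  window_set m U -> measurable (U : set pointsB).
Proof. by move=> mU; apply: borel_open; exact: window_set_open mU. Qed.

Lemma sub_setdiff_symU (S : Type) (B C E F : set S) :
  setdiff_sym (B `|` C) (E `|` F) `<=` setdiff_sym B E `|` setdiff_sym C F.
Proof. by rewrite /setdiff_sym /= => x /=; tauto. Qed.

Lemma setdiff_symC (S : Type) (B E : set S) :
  setdiff_sym (~` B) (~` E) = setdiff_sym B E.
Proof.
by apply/seteqP; rewrite /setdiff_sym; split=> x /=;
  have [] := pselect (B x); have [] := pselect (E x); tauto.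
Qed.

Lemma measurable_setdiff_sym (B E : set pointsB) :
  measurable B -> measurable E -> measurable (setdiff_sym B E).
Proof. by move=> mB mE; apply: measurableU; exact: measurableD. Qed.

Lemma fine_prob_le_symdiff (rho : probability pointsB R) (C D : set pointsB) :
  measurable C -> measurable D ->
  fine (rho C) <= fine (rho D) + fine (rho (setdiff_sym C D)).
Proof.
move=> mC mD; have mS := measurable_setdiff_sym mC mD.
apply: le_trans (fine_probU rho mD mS).
apply: fine_prob_le => //; first exact: measurableU.
by move=> x Cx; have [Dx|Dx] := pselect (D x); [left|right; left].
Qed.

Lemma sub_setdiff_sym_trans (S : Type) (B C E : set S) : C `<=` B ->
  setdiff_sym B E `<=` (B `\` C) `|` setdiff_sym C E.
Proof.
move=> CB x; rewrite /setdiff_sym /= => -[[Bx Ex]|[Ex Bx]].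
  by have [Cx|Cx] := pselect (C x); [right; left|left].
by right; right; split=> // /CB.
Qed.

(** The two measures share the same E. This is what transfers domination from words to Borel sets: a
    null set of one measure must be approximated by a set that is small for it and still close for
    the other. *)
Lemma borel_approx (nu : bool -> probability pointsB R) (B : set pointsB)
    (eps : R) : measurable B -> 0 < eps ->
  exists m (E : set (points X)), window_set m E /\
    forall b, fine (nu b (setdiff_sym B E)) <= eps.
Proof.
move=> mB; elim/borel_ind: mB eps => [U oU|C mC IH|F mF IH] eps eps0.
- have mcore m : measurable (window_core m U : set pointsB).
    exact: window_set_measurable (@window_core_window _ _ m U).
  have cmono := @window_core_mono _ _ U.
  have [m mP] := increasing_limit_pair nu mcore cmono eps0.
  exists m, (window_core m U); split; first exact: window_core_window.
  have -> : setdiff_sym U (window_core m U) =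
      \bigcup_n window_core n U `\` window_core m U.
    rewrite bigcup_window_core// /setdiff_sym; apply/seteqP; split=> x /=; last by left.
    by move=> [//|[xm nU]]; exfalso; apply: nU; exact: xm.
  exact: mP.
- have [m [E [mE Ee]]] := IH _ eps0; exists m, (~` E).
  by split=> [|b]; [exact: window_setC|rewrite setdiff_symC].
- pose G n := \big[setU/set0]_(i < n) F i.
  have mG n : measurable (G n) by apply: bigsetU_measurable => i _; exact: mF.
  have Gmono : {homo G : m n / (m <= n)%N >-> m `<=` n}.
    by move=> m n mn; exact: subset_bigsetU.
  have IHG n e : 0 < e -> exists m (E : set (points X)), window_set m E /\
      forall b, fine (nu b (setdiff_sym (G n) E)) <= e.
    elim: n e => [|n IHn] e e0.
      exists 0%N, set0; split=> [//|b].
      rewrite /setdiff_sym /G big_ord0 setD0 set0U measure0.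
      exact: ltW.
    have e20 : 0 < e / 2 by exact: divr_gt0.
    have [m1 [E1 [mE1 e1]]] := IHn _ e20.
    have [m2 [E2 [mE2 e2]]] := IH n _ e20.
    exists (maxn m1 m2), (E1 `|` E2); split=> [x y xy [E1x|E2x]|b].
    - by left; exact: window_set_le (leq_maxl _ _) mE1 _ _ xy E1x.
    - by right; exact: window_set_le (leq_maxr _ _) mE2 _ _ xy E2x.
    have M1 := window_set_measurable mE1; have M2 := window_set_measurable mE2.
    rewrite /G big_ord_recr /= -/(G n).
    apply: (@le_trans _ _ (fine (nu b
        (setdiff_sym (G n) E1 `|` setdiff_sym (F n) E2)))).
      apply: fine_prob_le; last exact: sub_setdiff_symU.
      + by apply: measurable_setdiff_sym; exact: measurableU.
      + by apply: measurableU; exact: measurable_setdiff_sym.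
    apply: le_trans (fine_probU _ _ _) _; [exact: measurable_setdiff_sym..|].
    by rewrite [leRHS]splitr lerD.
  have FG : \bigcup_n F n = \bigcup_n G n.
    apply/seteqP; split=> x [n _]; last first.
      by rewrite /G -bigcup_mkord => -[i _ Fx]; exists i.
    by exists n.+1 => //; rewrite /G big_ord_recr; right.
  have e2 : 0 < eps / 2 by exact: divr_gt0.
  have [N NP] := increasing_limit_pair nu mG Gmono e2.
  have [m [E [mE Ee]]] := IHG N _ e2; exists m, E; split=> // b.
  have ME := window_set_measurable mE; rewrite FG.
  have mU : measurable (\bigcup_n G n) by exact: bigcupT_measurable.
  apply: (@le_trans _ _ (fine (nu b
      ((\bigcup_n G n `\` G N) `|` setdiff_sym (G N) E)))).
    apply: fine_prob_le.
    + exact: measurable_setdiff_sym.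
    + apply: measurableU; first exact: measurableD.
      exact: measurable_setdiff_sym.
    + by apply: sub_setdiff_sym_trans; exact: bigcup_sup.
  apply: le_trans (fine_probU _ _ _) _; first exact: measurableD.
    exact: measurable_setdiff_sym.
  by rewrite [leRHS]splitr lerD.
Qed.

End Approximation.

(** * Block entropy *)

Lemma limn_esup_le (R : realType) (u : nat -> \bar R) (c : \bar R) :
  (\forall n \near \oo, (u n <= c)%E) -> (limn_esup u <= c)%E.
Proof.
move=> uc; apply: (@le_trans _ _ (ereal_sup (u @` [set n | (u n <= c)%E]))).
  by apply: ereal_inf_lbound; exists [set n | (u n <= c)%E].
by apply: ge_ereal_sup => _ [n /= un <-].
Qed.

Lemma limn_esup_ge (R : realType) (u : nat -> \bar R) (c : \bar R) :
  (\forall n \near \oo, (c <= u n)%E) -> (c <= limn_esup u)%E.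
Proof.
move=> uc; apply: le_ereal_inf_tmp => _ [V [N _ NV] <-].
have [M _ MP] := uc; apply: (@le_trans _ _ (u (maxn N M))).
  by apply: MP; rewrite /= leq_maxr.
by apply: ereal_sup_ubound; exists (maxn N M) => //; apply: NV; rewrite /= leq_maxl.
Qed.

Lemma le_of_linear_growth (R : realType) (a b c : R) :
  (forall k, k%:R * a <= k%:R * b + c) -> a <= b.
Proof.
move=> H; rewrite leNgt; apply/negP => ba.
have ab : 0 < a - b by rewrite subr_gt0.
pose n := (Num.truncn (`|c| / (a - b))).+1.
have := H n; rewrite -lerBlDl -mulrBr => Hn.
have : `|c| / (a - b) < n%:R by rewrite /n truncnS_gt.
rewrite ltr_pdivrMr// => cn.
by have := lt_le_trans cn (le_trans Hn (ler_norm c)); rewrite ltxx.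
Qed.

Lemma fine_prob_cover (d : measure_display) (T : measurableType d)
    (R : realType) (mu : probability T R) (I : finType) (B : set T)
    (C : I -> set T) :
  measurable B -> (forall i, measurable (C i)) ->
  (forall x, B x -> exists i, C i x) -> fine (mu B) <= \sum_i fine (mu (C i)).
Proof.
move=> mB mC BC.
have {}BC x : B x -> exists2 i, i \in index_enum I & C i x.
  by move=> /BC[i Ci]; exists i; rewrite ?mem_index_enum.
elim: (index_enum I) B mB BC => [|i s IH] B mB BC.
  rewrite big_nil (_ : B = set0) ?measure0//.
  by rewrite -subset0 => x /BC[].
rewrite big_cons.
apply: (@le_trans _ _ (fine (mu (C i `|` (B `\` C i))))).
  apply: fine_prob_le => //; first by apply: measurableU => //; exact: measurableD.
  by move=> x Bx; have [Cx|Cx] := pselect (C i x); [left|right].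
apply: le_trans (fine_probU _ (mC i) (measurableD mB (mC i))) _.
rewrite lerD2l; apply: IH; first exact: measurableD.
move=> x [Bx nC]; have [j + Cj] := BC x Bx.
by rewrite inE => /orP[/eqP ji|js]; [rewrite ji in Cj|exists j].
Qed.

Section BlockEntropy.
Variables (A : finType) (X : subshift A) (R : realType).
Notation pointsB := (borel (points X)).
Variable mu : probability pointsB R.
Notation sg := (@sigma A X).

Definition block_entropy n : R :=
  partition_entropy mu (word n 0 : pointsB -> {ffun 'I_n -> A}).

Lemma word_measurable n j :
  finite_measurable (word n j : pointsB -> {ffun 'I_n -> A}).
Proof.
move=> w; apply: (@window_set_measurable _ _ (`|j|%N + n)%N) => x y xy <-.
apply/word_eqP => i ilt; apply: xy; lia.
Qed.

Lemma sigma_continuous : continuous (sg : points X -> points X).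
Proof.
apply/continuousP => U oU; rewrite openE => x Ux.
have [m mU] := open_window oU Ux.
apply: (filterS (P := ball_window m.+1 x)); last first.
  by apply: open_nbhs_nbhs; split; [exact: open_ball_window|].
move=> y yx; apply: mU => j jm; rewrite -/(at_ _ j) -/(at_ _ j) !at_sigma.
by apply: yx; lia.
Qed.

Lemma sigma_preimage_measurable k (B : set pointsB) : measurable B ->
  measurable (iter k sg @^-1` B : set pointsB).
Proof.
move=> mB; elim: k => [//|k IH].
rewrite (_ : _ @^-1` B = sg @^-1` (iter k sg @^-1` B)).
  by apply: continuous_preimage_borel => //; exact: sigma_continuous.
by apply/seteqP; split=> x /=; rewrite -iterSr.
Qed.

Hypothesis invmu : invariant_measure mu (sg : pointsB -> pointsB).

Lemma iter_sigma_invariant k (B : set pointsB) : measurable B ->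
  mu (iter k sg @^-1` B) = mu B.
Proof.
move=> mB; elim: k => [//|k IH].
rewrite (_ : _ @^-1` B = sg @^-1` (iter k sg @^-1` B)).
  by rewrite invmu//; exact: sigma_preimage_measurable.
by apply/seteqP; split=> x /=; rewrite -iterSr.
Qed.

Lemma word_preimage_invariant n j (E : set {ffun 'I_n -> A}) :
  mu (word n j @^-1` E) = mu (word n 0 @^-1` E).
Proof.
have step i (k : nat) : mu (word n i @^-1` E) = mu (word n (i + k%:Z) @^-1` E).
  rewrite -(@iter_sigma_invariant k); last first.
    by apply: finite_measurable_preimage; exact: word_measurable.
  congr (mu _); apply/seteqP; split=> x /=; congr E; apply/word_eqP => l _;
    by rewrite at_iter_sigma; congr at_; lia.
case: j => j; first by rewrite -{1}[Posz j]add0r -step.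
by rewrite (step (Negz j) j.+1); congr (mu (word n _ @^-1` E)); lia.
Qed.

Lemma partition_entropy_word n j :
  partition_entropy mu (word n j : pointsB -> _) = block_entropy n.
Proof.
rewrite /block_entropy /partition_entropy; congr (- _).
by apply: eq_bigr => w _; rewrite word_preimage_invariant.
Qed.

Lemma block_entropyD n m :
  block_entropy (n + m) <= block_entropy n + block_entropy m.
Proof.
pose f (uv : {ffun 'I_n -> A} * {ffun 'I_m -> A}) : {ffun 'I_(n + m) -> A} :=
  [ffun i => match fintype.split i with inl a => uv.1 a | inr b => uv.2 b end].
have -> : block_entropy (n + m) = partition_entropy mu
    (f \o (fun x : pointsB => (word n 0 x, word m n%:Z x))).
  rewrite /block_entropy; congr partition_entropy; apply/funext => x /=.
  apply/ffunP => i; rewrite !ffunE /=.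
  by case: splitP => k e; rewrite !ffunE; congr at_; lia.
apply: le_trans (partition_entropy_le _ _ _) _.
  by apply: finite_measurable_pair; exact: word_measurable.
rewrite -(partition_entropy_word m n%:Z).
by apply: partition_entropy_pair; exact: word_measurable.
Qed.

Lemma block_entropy_mono n m : (n <= m)%N -> block_entropy n <= block_entropy m.
Proof.
move=> nm; rewrite {1}/block_entropy.
rewrite (_ : (word n 0 : pointsB -> _) = subword X n 0 \o (word m 0 : pointsB -> _)).
  by apply: partition_entropy_le; exact: word_measurable.
by apply/funext => x /=; rewrite subword_word.
Qed.

Lemma block_entropy_le_lang n : block_entropy n <= ln #|lang X n|%:R.
Proof.
apply: partition_entropy_le_card; first exact: word_measurable.
exact: word_in_lang.
Qed.

Lemma block_entropy_ge0 n : 0 <= block_entropy n.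
Proof.
by have := le_trans (block_entropy_mono (leq_addr n n)) (block_entropyD n n); lra.
Qed.

Lemma block_entropyM k n : block_entropy (k * n) <= k%:R * block_entropy n.
Proof.
elim: k => [|k IH].
  rewrite mul0n mul0r (le_trans (block_entropy_le_lang 0))// -[leRHS]ln1.
  rewrite ler_ln ?posrE ?ltr0n ?card_lang_gt0// lern1.
  by rewrite (leq_trans (card_lang_le X 0)).
rewrite mulSn (le_trans (block_entropyD _ _))// mulrSr mulrDl mul1r addrC.
by rewrite lerD2r.
Qed.

(** N is rounded up to a multiple of n, which lies below N + n, and subadditivity is used on the
    blocks. *)
Lemma block_entropy_rate n N : (0 < n)%N ->
  n%:R * block_entropy N <= (N + n)%:R * block_entropy n.
Proof.
move=> n0; have Nk : (N <= (N %/ n).+1 * n)%N by rewrite ltnW// ltn_ceil.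
have := le_trans (block_entropy_mono Nk) (block_entropyM _ _).
move=> /(ler_wpM2l (ler0n R n)) H; apply: (le_trans H).
rewrite mulrA ler_wpM2r ?block_entropy_ge0// -natrM ler_nat.
by rewrite mulnS addnC leq_add2r mulnC leq_divM.
Qed.

(** The value is arbitrary if w does not occur at j; it is meaningful on words read off a point. *)
Definition representative n j (w : {ffun 'I_n -> A}) : points X :=
  get (fun x => word n j x = w).

Lemma word_representative n j (x : points X) :
  word n j (representative j (word n j x)) = word n j x.
Proof.
rewrite /representative.
by apply: (@getPex _ (fun y : points X => word n j y = _)); exists x.
Qed.

(* A measurable labelling is replaced by a labelling of windows that differs
   from it on a set of small measure. *)
Lemma partition_join_entropy_le (I : finType) (V : pointsB -> I) (eta : R) :
  finite_measurable V -> 0 < eta -> exists m, forall N,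
    partition_entropy mu (@partition_join _ pointsB sg I V N) <=
    block_entropy (N + m) + N%:R * eta.
Proof.
move=> mV eta0; have [eps eps0 hamming] := @entropy_of_hamming R I _ eta0.
have I0 : (0 < #|I|)%N by apply/card_gt0P; exists (V point).
pose e1 := eps / #|I|%:R.
have e10 : 0 < e1 by rewrite divr_gt0// ltr0n.
have /choice[mE mEP] (i : I) : exists mE : nat * set (points X),
    window_set mE.1 mE.2 /\
    fine (mu (setdiff_sym (V @^-1` [set i]) mE.2)) <= e1.
  have [m [E [mE Ee]]] := borel_approx (fun=> mu) (mV i) e10.
  by exists (m, E); split=> //; exact: (Ee true).
pose m := (\max_i (mE i).1)%N.
have mEm i : window_set m (mE i).2.
  by apply: window_set_le (mEP i).1; exact: leq_bigmax.
(* Where the approximating sets overlap or leave a gap, the label is arbitrary; such points already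
   lie in one of the symmetric differences, each of measure at most eps / |I|. *)
pose q x : I := odflt (V point) [pick i | `[< (mE i).2 x >]].
have q_window x y : ball_window m x y -> q x = q y.
  move=> xy; rewrite /q; congr odflt; apply: eq_pick => i; apply/asboolP/asboolP.
    exact: mEm xy.
  exact: mEm (ball_windowC xy).
have mq : finite_measurable (q : pointsB -> I).
  move=> i; apply: (@window_set_measurable _ _ m) => x y xy /= <-.
  exact/esym/q_window.
have mdiff j : measurable ([set x | V (iter j sg x) != q (iter j sg x)] : set pointsB).
  rewrite (_ : [set x | _] = iter j sg @^-1` ((fun x : pointsB => (V x, q x)) @^-1`
    [set vq | vq.1 != vq.2])); last by apply/seteqP; split.
  apply: sigma_preimage_measurable; apply: finite_measurable_preimage.
  exact: finite_measurable_pair.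
have Vq : fine (mu [set x | V x != q x]) <= eps.
  have mD i := measurable_setdiff_sym (mV i) (window_set_measurable (mEP i).1).
  apply: (le_trans (fine_prob_cover mu (mdiff 0%N) mD _)).
    move=> x /= Vqx; apply: contrapT => nD; move: Vqx; apply/negP; rewrite negbK.
    have VE i : V x = i <-> (mE i).2 x.
      split=> [Vi|Ei]; apply: contrapT => h; apply: nD; exists i.
        by left; split.
      by right; split.
    rewrite /q; case: pickP => [i /asboolP /VE -> //|h].
    by have := h (V x); rewrite asboolT//; exact/VE.
  rewrite (le_trans (ler_sum _ (fun i _ => (mEP i).2)))//.
  by rewrite sumr_const -mulr_natr /e1 divfK// pnatr_eq0 -lt0n.
(* The labels at times 0, ..., N-1 read the coordinates from -m to N-1+m. There is a single
   candidate (T = 0), so the index costs ln 1 = 0. *)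
exists (m + m)%N => N.
pose Z := word (N + (m + m)) (- m%:Z) : pointsB -> {ffun 'I_(N + (m + m)) -> A}.
have mZ : finite_measurable Z by exact: word_measurable.
pose J := @partition_join _ pointsB sg I V N : pointsB -> {ffun 'I_N -> I}.
have mJ : finite_measurable J.
  have mk (k : 'I_N) : finite_measurable ((fun x => V (iter k sg x)) : pointsB -> I).
    by move=> i; exact: (sigma_preimage_measurable k (mV i)).
  exact: (finite_measurable_ffun mk).
have mW := finite_measurable_pair mJ mZ.
pose F (_ : 'I_1) (z : {ffun 'I_(N + (m + m)) -> A}) : {ffun 'I_N -> I} :=
  [ffun i : 'I_N => q (iter i sg (representative (- m%:Z) z))].
have := hamming _ _ (law_ge0 mu (fun x : pointsB => (J x, Z x))) (law_sum1 mu mW)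
  N fst _ snd 0%N F (fun=> ord0).
rewrite ln1 addr0 -!partition_entropyE//.
rewrite (_ : snd \o _ = Z) // /Z partition_entropy_word; apply=> j.
rewrite law_sum// (_ : _ @^-1` _ = iter j sg @^-1` [set x | V x != q x]).
  by rewrite iter_sigma_invariant//; exact: (mdiff 0%N).
suff e (x : points X) : F ord0 (Z x) j = q (iter j sg x).
  by apply/seteqP; split=> x /=; rewrite unfold_in /= -/(Z x) e /J ffunE.
rewrite ffunE; apply: q_window => k km.
have /word_eqP/(_ `|(k + j%:Z + m%:Z)%R|%N) :=
  word_representative (N + (m + m)) (- m%:Z) x.
rewrite -/(at_ _ k) -/(at_ _ k) !at_iter_sigma.
have -> : - m%:Z + `|(k + j%:Z + m%:Z)%R|%N%:Z = k + j%:Z by lia.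
by move=> e; apply/esym/e; have := ltn_ord j; lia.
Qed.

End BlockEntropy.

(** * From block entropy to measure-theoretic and topological entropy *)

Section Entropies.
Variables (A : finType) (X : subshift A) (R : realType).
Notation pointsB := (borel (points X)).
Notation sg := (@sigma A X).

(** Any finite partition is approximated by windows, so its N-fold join costs at most H_(N+m) plus a
    small multiple of N; dividing by N and using subadditivity leaves H_n / n. *)
Lemma measure_entropy_le (mu : probability pointsB R) n :
  invariant_measure mu (sg : pointsB -> pointsB) -> (0 < n)%N ->
  (measure_entropy mu (sg : pointsB -> pointsB) <= (block_entropy mu n / n%:R)%:E)%E.
Proof.
move=> inv n0; apply: ge_ereal_sup => _ [k [V [mV ->]]].
apply/lee_addgt0Pr => e e0; have e20 : 0 < e / 2 by exact: divr_gt0.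
have [m Hm] := partition_join_entropy_le inv mV e20.
rewrite -EFinD; apply: limn_esup_le.
set b := block_entropy mu n / n%:R.
have b0 : 0 <= b by rewrite divr_ge0// block_entropy_ge0.
exists (Num.truncn ((m + n)%:R * b / (e / 2))).+1 => // N /= NN.
have N0 : 0 < N%:R :> R by rewrite ltr0n; exact: leq_ltn_trans NN.
have {NN} : (m + n)%:R * b / (e / 2) < N%:R.
  by apply: lt_le_trans (truncnS_gt _) _; rewrite ler_nat.
rewrite ltr_pdivrMr// => NN; rewrite lee_fin ler_pdivrMl//.
apply: (le_trans (Hm N)).
have : block_entropy mu (N + m) <= (N + m + n)%:R * b.
  rewrite /b mulrA ler_pdivlMr ?ltr0n// mulrC.
  exact: block_entropy_rate.
move: NN; rewrite !natrD; move: (block_entropy mu (N + m)) b0 => h b0 NN hb.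
apply: le_trans (_ : (N%:R + m%:R + n%:R) * b + N%:R * (e / 2) <= _).
  by rewrite lerD2r.
by rewrite -subr_ge0; move: (ltW NN); rewrite -subr_ge0; congr (0 <= _); field.
Qed.

(** A member of the join of the coordinate cover fixes n letters, so a subcover needs a different
    member for each word; [f] assigns them injectively. *)
Lemma cover_entropy_coordinate_ge n :
  ((ln #|lang X n|%:R)%:E <= cover_entropy R (cover_join sg
    (range (fun a : A => [set x : points X | at_ x 0 = a])) n))%E.
Proof.
apply: le_ereal_inf_tmp => _ [k [V [Vj Vcov ->]]].
have /choice[f fP] (w : {ffun 'I_n -> A}) :
    exists i : option 'I_k, w \in lang X n -> exists2 j, i = Some j &
      exists2 x, word n 0 x = w & V j x.
  have [/langP[x xw]|_] := boolP (w \in lang X n); last by exists None.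
  have : [set: points X] x by []. rewrite -Vcov => -[j _ Vx].
  by exists (Some j) => _; exists j => //; exists x.
have finj : {in lang X n &, injective f}.
  move=> w w' wl w'l; have [j -> [x <- Vx]] := fP w wl.
  have [j' -> [x' <- Vx']] := fP w' w'l => -[jj']; rewrite -jj' in Vx' => {jj'}.
  have [U [UP UE]] := Vj j; rewrite UE in Vx Vx'.
  apply/word_eqP => i ilt; rewrite !add0r.
  have [a _ aE] := UP i ilt.
  have := Vx i ilt; have := Vx' i ilt; rewrite -aE /= !at_iter_sigma !add0r.
  by move=> -> ->.
have kn : (#|lang X n| <= k)%N.
  rewrite -(card_in_imset finj).
  have sub : f @: lang X n \subset Some @: [set: 'I_k]%SET.
    apply/fintype.subsetP => _ /imsetP[w wl ->]; have [j -> _] := fP w wl.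
    by apply/imsetP; exists j; rewrite ?inE.
  rewrite (leq_trans (subset_leq_card sub))// card_imset; last by move=> ? ? [].
  by rewrite cardsT card_ord.
have L0 := card_lang_gt0 X n.
by rewrite lee_fin ler_ln ?posrE ?ltr0n ?ler_nat// (leq_trans L0).
Qed.

(** Both sides are compared through |L_(nN)|, cut into N words of length n on the left and n words
    of length N on the right. *)
Lemma lang_growth C n N : (0 < C)%N ->
  (forall n m, (#|lang X n| * #|lang X m| <= C * #|lang X (n + m)|)%N) ->
  N%:R * (ln #|lang X n|%:R - ln C%:R) <= n%:R * ln #|lang X N|%:R :> R.
Proof.
move=> C0 sup; have L0 := card_lang_gt0 X.
have H1 k : (#|lang X n| ^ k <= C ^ k * #|lang X (k * n)|)%N.
  elim: k => [|k IH]; first by rewrite mul1n.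
  rewrite expnSr (leq_trans (leq_mul IH (leqnn _)))// -mulnA expnS.
  by rewrite [(C * _)%N]mulnC -mulnA leq_mul2l mulSn addnC sup orbT.
have H2 k : (#|lang X (k * N)| <= #|lang X N| ^ k)%N.
  elim: k => [|k IH]; first by rewrite (leq_trans (card_lang_le X 0)).
  by rewrite mulSn expnS (leq_trans (lang_submul X _ _))// leq_mul2l IH orbT.
have : (#|lang X n| ^ N <= C ^ N * #|lang X N| ^ n)%N.
  by rewrite (leq_trans (H1 N))// leq_mul2l mulnC H2 orbT.
have P0 m : 0 < #|lang X m|%:R :> R by rewrite ltr0n.
have PC : 0 < C%:R :> R by rewrite ltr0n.
rewrite -(ler_nat R) natrM !natrX => H.
rewrite mulrBr lerBlDl !mulr_natl -!lnXn// -lnM ?posrE ?exprn_gt0//.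
by rewrite ler_ln// posrE ?mulr_gt0 ?exprn_gt0.
Qed.

Lemma topological_entropy_ge C n : (0 < C)%N -> (0 < n)%N ->
  (forall n m, (#|lang X n| * #|lang X m| <= C * #|lang X (n + m)|)%N) ->
  (((ln #|lang X n|%:R - ln C%:R) / n%:R)%:E <= topological_entropy R sg)%E.
Proof.
move=> C0 n0 sup.
apply: le_trans (ereal_sup_ubound _); last first.
  exists (range (fun a : A => [set x : points X | at_ x 0 = a])); last by [].
  split=> [_ [a _ <-]|]; first exact: open_at.
  apply/seteqP; split=> [//|x _].
  exists [set y | at_ y 0 = at_ x 0]; last by [].
  by exists (at_ x 0).
apply: limn_esup_ge; exists 1%N => // N /= N1.
have N0 : 0 < N%:R :> R by rewrite ltr0n.
apply: (@le_trans _ _ ((N%:R^-1)%:E * (ln #|lang X N|%:R)%:E)%E); last first.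
  by rewrite lee_wpmul2l ?lee_fin ?invr_ge0//; exact: cover_entropy_coordinate_ge.
rewrite -EFinM lee_fin ler_pdivlMl// mulrA ler_pdivrMr ?ltr0n//.
by rewrite [leRHS]mulrC; exact: lang_growth.
Qed.

(** The difference ln |L_n| - H_n is the relative entropy of the law of n-words with respect to the
    uniform distribution on L_n; it is bounded uniformly in n. *)
Definition near_uniform (mu : probability pointsB R) (c : R) :=
  forall n, ln #|lang X n|%:R - c <= block_entropy mu n.

(** For n > 0 the topological entropy is squeezed: (ln |L_n| - ln C) / n is at most it, and H_n / n
    is at least the entropy of mu, which equals it. *)
Lemma MME_near_uniform : is_SFT X -> irreducible X -> exists c,
  forall mu : probability pointsB R, is_MME mu -> near_uniform mu c.
Proof.
move=> sft irr; have [C C0 sup] := lang_supmul sft irr.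
exists (ln C%:R) => mu [inv ent] n.
have lnC : 0 <= ln C%:R :> R by rewrite ln_ge0// ler1n.
have [->|n0] := posnP n.
  apply: le_trans (block_entropy_ge0 inv 0).
  have L1 : (#|lang X 0| <= 1)%N by rewrite (leq_trans (card_lang_le X 0)).
  rewrite lerBlDr add0r (le_trans _ lnC)// ln_le0//.
  by rewrite lern1.
have := le_trans (topological_entropy_ge C0 n0 sup) _.
rewrite -ent => /(_ _ (measure_entropy_le inv n0)).
by rewrite lee_fin ler_pM2r// invr_gt0 ltr0n.
Qed.

End Entropies.

(** * Measures of maximal entropy and word counting *)

Section CrossEntropy.
Variables (d : measure_display) (T : measurableType d) (R : realType).
Variables (mu : probability T R) (I : finType) (W : T -> I).
Hypothesis mW : finite_measurable W.

Lemma law_neq0 i : law mu W i != 0 -> exists x, W x = i.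
Proof.
apply: contra_neqP => nW; rewrite /law (_ : _ @^-1` _ = set0) ?measure0//.
by rewrite -subset0 => x /= Wx; apply: nW; exists x.
Qed.

Lemma partition_entropy_le_cross (r : I -> R) : (forall i, 0 <= r i) ->
  \sum_i r i <= 1 -> (forall x, 0 < r (W x)) ->
  partition_entropy mu W <= - \sum_i law mu W i * ln (r i).
Proof.
move=> r0 r1 rpos; rewrite -[W in leLHS]/(id \o W) (partition_entropyE mu mW id).
apply: entropy_of_le_cross => //; [exact: law_ge0|exact: law_sum1|].
by move=> i /law_neq0[x <-].
Qed.

End CrossEntropy.

(** * Null sets of measures with a lower Gibbs bound *)

Section AbsoluteContinuity.
Variables (A : finType) (X : subshift A) (R : realType).
Notation pointsB := (borel (points X)).
Notation sg := (@sigma A X).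
Implicit Types mu nu : probability pointsB R.

(** The trial distribution [r] is half uniform on E and half uniform on L_n. A word of E costs at
    most ln (2 |E|), any other ln (2 |L_n|); near-uniformity limits the possible saving, so few
    words cannot carry much mass. *)
Lemma near_uniform_relative_entropy nu c n (E : {set {ffun 'I_n -> A}}) :
  near_uniform nu c -> E \subset lang X n -> (0 < #|E|)%N ->
  fine (nu (word n 0 @^-1` [set` E])) * ln (#|lang X n|%:R / #|E|%:R) <=
  c + ln 2.
Proof.
move=> /(_ n) unif EL E0; have L0 := card_lang_gt0 X n.
set l : R := #|lang X n|%:R in unif *; set e : R := #|E|%:R.
have l0 : 0 < l by rewrite ltr0n.
have e0 : 0 < e by rewrite ltr0n.
have le_ : e <= l by rewrite ler_nat subset_leq_card.
have mw := @word_measurable A X n 0.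
pose r (w : {ffun 'I_n -> A}) : R :=
  2^-1 * ((w \in E)%:R / e) + 2^-1 * ((w \in lang X n)%:R / l).
have rE w : w \in E -> (2 * e)^-1 <= r w.
  by move=> wE; rewrite /r wE mul1r invfM lerDl !mulr_ge0 ?invr_ge0 ?ler0n ?ltW//.
have rL w : w \in lang X n -> (2 * l)^-1 <= r w.
  by move=> wL; rewrite /r wL mul1r invfM lerDr !mulr_ge0 ?invr_ge0 ?ler0n ?ltW//.
have rge0 w : 0 <= r w.
  by rewrite /r addr_ge0// !mulr_ge0 ?invr_ge0 ?ler0n ?ltW//.
have rpos w : w \in lang X n -> 0 < r w.
  by move=> /rL; apply: lt_le_trans; rewrite invr_gt0 mulr_gt0.
have rsum : \sum_w r w <= 1.
  rewrite big_split /= -!big_distrr /= -!big_distrl /= -!natr_sum.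
  rewrite -!big_mkcond /= !sum1_card -/l -/e !divff ?gt_eqF// mulr1.
  by rewrite [leRHS]splitr !div1r.
have rposw x : 0 < r (word n 0 (x : points X)) by apply: rpos; exact: word_in_lang.
have := partition_entropy_le_cross nu mw rge0 rsum rposw.
rewrite -/(block_entropy nu n) => H.
have cost w : - (law nu (word n 0) w * ln (r w)) <= law nu (word n 0) w *
    (ln 2 + ln l) - (if w \in E then law nu (word n 0) w * ln (l / e) else 0).
  have [->|/law_neq0[x xw]] := eqVneq (law nu (word n 0) w) 0.
    by rewrite !mul0r oppr0 if_same subr0.
  have wL : w \in lang X n by rewrite -xw word_in_lang.
  have p0 := law_ge0 nu (word n 0 : pointsB -> {ffun 'I_n -> A}) w.
  case: ifPn => wE; last first.
    rewrite subr0 -mulrN ler_wpM2l// lerNl -lnM ?posrE// -lnV ?posrE ?mulr_gt0//.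
    by rewrite ler_ln ?posrE ?invr_gt0 ?mulr_gt0 ?rpos ?rL.
  rewrite -mulrBr -mulrN ler_wpM2l// ln_div ?posrE//.
  rewrite (_ : _ + _ - _ = ln 2 + ln e); last by ring.
  rewrite lerNl -lnM ?posrE// -lnV ?posrE ?mulr_gt0//.
  by rewrite ler_ln ?posrE ?invr_gt0 ?mulr_gt0 ?rpos ?rE.
have := le_trans (le_trans unif H) _; rewrite -sumrN => /(_ _ (ler_sum _ (fun w _ => cost w))).
rewrite sumrB -big_distrl /= law_sum1// mul1r -big_mkcond -big_distrl /=.
rewrite law_sum//; lra.
Qed.

(** The lower half of the Gibbs property, with 1 / |L_n| as the reference mass of an n-word. *)
Definition gibbs_lower mu (g : R) := forall n (a : {ffun 'I_n -> A}),
  a \in lang X n -> g <= #|lang X n|%:R * fine (mu (word n 0 @^-1` [set a])).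

Lemma window_set_words m (E : set (points X)) : window_set m E ->
  E = word (m.*2.+1) (- m%:Z) @^-1` [set` [set w : {ffun 'I_(m.*2.+1) -> A} |
        `[< exists2 x, word (m.*2.+1) (- m%:Z) x = w & E x >]]%SET].
Proof.
move=> mE; apply/seteqP; split=> x /=; rewrite inE.
  by move=> Ex; apply/asboolP; exists x.
move=> /asboolP[y yx Ey]; apply: mE Ey => j jm.
move/word_eqP/(_ `|(j + m%:Z)%R|%N): yx.
rewrite (_ : - m%:Z + `|(j + m%:Z)%R|%N%:Z = j); last by lia.
by move=> e; apply/esym/e; lia.
Qed.

Lemma near_uniform_dominated nu mu c g :
  invariant_measure nu (sg : pointsB -> pointsB) ->
  invariant_measure mu (sg : pointsB -> pointsB) ->
  near_uniform nu c -> 0 < g -> gibbs_lower mu g ->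
  forall B : set pointsB, measurable B -> mu B = 0%E -> nu B = 0%E.
Proof.
move=> invn invm unif g0 gibbs B mB muB.
rewrite -(fine_probK nu mB); congr (_%:E); apply/eqP.
rewrite eq_le fine_prob_ge0 andbT; apply/ler_addgt0Pr => eta eta0; rewrite add0r.
(* If E has at most exp(-M) |L_n| words, then M nu(E) <= c + ln 2, whence nu(E) <= eta/2; the added
   1 keeps M positive. By the lower bound, mu(E) <= g exp(-M) forces this word count. *)
pose M := `|c + ln 2| / (eta / 2) + 1.
have eta2 : 0 < eta / 2 by exact: divr_gt0.
have M0 : 0 < M by rewrite ltr_wpDl// divr_ge0// ltW.
pose eps := Num.min (g * expR (- M)) (eta / 2).
have eps0 : 0 < eps by rewrite lt_min eta2 mulr_gt0// expR_gt0.
have [m [E [mE Ee]]] := borel_approx (fun b => if b then nu else mu) mB eps0.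
have nuE := Ee true; have muE := Ee false; rewrite /= in nuE muE.
have ME := window_set_measurable mE.
have nuB := fine_prob_le_symdiff nu mB ME.
have {}muE : fine (mu E) <= g * expR (- M).
  have := fine_prob_le_symdiff mu ME mB.
  rewrite muB /= add0r /setdiff_sym setUC => /le_trans; apply.
  by apply: (le_trans muE); rewrite ge_min lexx.
have {}nuE : fine (nu (setdiff_sym B E)) <= eta / 2.
  by apply: (le_trans nuE); rewrite ge_min lexx orbT.
apply: (le_trans nuB); rewrite [leRHS]splitr lerD//.
move: muE; rewrite (window_set_words mE).
set n := m.*2.+1; set F : {set {ffun 'I_n -> A}} := [set w | _]%SET.
rewrite !word_preimage_invariant// => muE.
have FL : F \subset lang X n.
  by apply/fintype.subsetP => w; rewrite inE => /asboolP[x <- _]; exact: word_in_lang.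
have mw := @word_measurable A X n 0.
have [F0|F0] := posnP #|F|.
  rewrite (_ : _ @^-1` _ = set0) ?measure0 ?ltW//.
  by rewrite -subset0 => x /=; rewrite (cards0_eq F0) inE.
have L0 : 0 < #|lang X n|%:R :> R by rewrite ltr0n card_lang_gt0.
have F0' : 0 < #|F|%:R :> R by rewrite ltr0n.
have Fg : #|F|%:R * g <= #|lang X n|%:R * fine (mu (word n 0 @^-1` [set` F])).
  rewrite -(law_sum mu mw) big_distrr /= mulr_natl -sumr_const.
  apply: ler_sum => w wF; apply: gibbs; exact: (fintype.subsetP FL).
have ML : M <= ln (#|lang X n|%:R / #|F|%:R).
  have H : #|F|%:R * g <= #|lang X n|%:R * expR (- M) * g.
    by rewrite (le_trans Fg)// -mulrA [expR _ * g]mulrC ler_wpM2l.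
  rewrite -[M]expRK ler_ln ?posrE ?expR_gt0 ?divr_gt0// ler_pdivlMr//.
  by move: H; rewrite ler_pM2r// expRN ler_pdivlMr ?expR_gt0// mulrC.
have := near_uniform_relative_entropy unif FL F0.
move=> /(le_trans (ler_wpM2l (fine_prob_ge0 nu _) ML)).
move=> /le_trans /(_ (ler_norm _)).
rewrite -ler_pdivlMr// => /le_trans; apply.
rewrite ler_pdivrMr// /M mulrDr mulr1 mulrC divfK ?gt_eqF// lerDl.
exact: ltW.
Qed.

End AbsoluteContinuity.
 

(** * The lower Gibbs bound by refilling blocks *)

Section GibbsLowerBound.
Variables (A : finType) (X : subshift A) (R : realType).
Notation pointsB := (borel (points X)).
Notation sg := (@sigma A X).

Definition blocks M k (x : points X) : {ffun 'I_k -> {ffun 'I_M -> A}} :=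
  [ffun i : 'I_k => word M (i * M)%N%:Z x].

Lemma blocks_word M k x y :
  blocks M k x = blocks M k y <-> word (k * M) 0 x = word (k * M) 0 y.
Proof.
split=> [/ffunP e|e].
  apply/word_eqP => i ilt; have M0 : (0 < M)%N by case: M ilt {e} => //; rewrite muln0.
  have ik : (i %/ M < k)%N by rewrite ltn_divLR.
  have := e (Ordinal ik); rewrite !ffunE /= => /word_eqP/(_ (i %% M)%N (ltn_pmod i M0)).
  by rewrite -PoszD -divn_eq !add0r.
apply/ffunP => i; rewrite !ffunE -[Posz _]add0r.
apply: word_determines e; rewrite addnC -mulSn leq_mul2r.
by rewrite ltn_ord orbT.
Qed.

Lemma blocks_measurable M k : finite_measurable (blocks M k : pointsB -> _).
Proof.
apply: (finite_measurable_ffun (V := fun (i : 'I_k) (x : pointsB) =>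
  word M (i * M)%N%:Z (x : points X))) => i.
exact: word_measurable.
Qed.

(** If a were too rare, a trial distribution penalising the blocks that contain a would be a better
    code for mu than near-uniformity allows. Its normalising constant gains k / (2 |L_M|) in
    logarithm over k blocks of length M, by refilling, while the penalty costs at most k t, with t
    the measure of the blocks containing a. *)
Lemma near_uniform_gibbs (mu : probability pointsB R) c :
  is_SFT X -> irreducible X -> invariant_measure mu (sg : pointsB -> pointsB) ->
  near_uniform mu c -> exists2 g, 0 < g & gibbs_lower mu g.
Proof.
move=> sft irr inv unif; have [K refill] := window_refill sft irr.
have A0 : (0 < #|A|)%N by apply/card_gt0P; exists (at_ (point : points X) 0).
(* The 2 comes from the weight 1/2, |A|^K bounds |L_(n+K)| / |L_n|, and K+1 counts the offsets of a
   in a block. *)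
pose D : R := 2 * (#|A| ^ K)%:R * K.+1%:R.
have D0 : 0 < D by rewrite !mulr_gt0 ?ltr0n ?expn_gt0 ?A0.
exists D^-1 => [|n a aL]; first by rewrite invr_gt0.
pose M := (n + K)%N; pose B := {ffun 'I_M -> A}.
pose G : {set B} := [set b | [exists t : 'I_K.+1, subword X n t b == a]]%SET.
pose w (b : B) : R := if b \in G then 2^-1 else 1.
have mw j := @word_measurable A X M j.
pose t : R := fine (mu (word M 0 @^-1` [set` G])).
have tle : t <= K.+1%:R * fine (mu (word n 0 @^-1` [set a])).
  apply: le_trans (@fine_prob_cover _ _ _ mu _ _
    (fun l : 'I_K.+1 => word n l%:Z @^-1` [set a]) _ _ _) _.
  - exact: finite_measurable_preimage.
  - by move=> l; exact: word_measurable.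
  - move=> x /=; rewrite inE => /existsP[l /eqP la]; exists l.
    by rewrite -la subword_word ?add0r// -ltnS addnC /M; have := ltn_ord l; lia.
  under eq_bigr do rewrite word_preimage_invariant//.
  by rewrite sumr_const card_ord mulr_natl.
have key k : k%:R * (2 * #|lang X M|%:R)^-1 <= k%:R * t + c.
  pose L : {set {ffun 'I_k -> B}} := [set u | `[< exists x, blocks M k x = u >]]%SET.
  have LP u : reflect (exists x, blocks M k x = u) (u \in L).
    by rewrite inE; exact: asboolP.
  have LD (u : {ffun 'I_k -> B}) i : u \in L -> u i \in lang X M.
    by move=> /LP[x <-]; rewrite ffunE word_in_lang.
  have Lrefill (u : {ffun 'I_k -> B}) i : u \in L -> exists2 v, v \in L &
      (forall j, j != i -> v j = u j) /\ v i \in G.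
    move=> /LP[x <-]; have [y [l [lK yx ya]]] := refill n a aL x (i * M)%N%:Z.
    exists (blocks M k y); first by apply/LP; exists y.
    split=> [j ji|]; rewrite !ffunE.
      apply/word_eqP => r rlt; apply: yx.
      have : (j < i)%N || (i < j)%N by rewrite -neq_ltn.
      case/orP => [jlt|jgt].
        have : (j.+1 * M <= i * M)%N by rewrite leq_mul2r jlt orbT.
        by rewrite mulSn; lia.
      have : (i.+1 * M <= j * M)%N by rewrite leq_mul2r jgt orbT.
      by rewrite mulSn -/M; lia.
    rewrite inE; apply/existsP; exists (inord l); rewrite inordK ?ltnS//.
    by rewrite subword_word ?ya// addnC leq_add2l.
  have := refill_weight R LD Lrefill; rewrite -/w.
  set W := \sum_(u in L) \prod_i w (u i) => Wle.
  have w0 b : 0 < w b by rewrite /w; case: ifP => _; rewrite ?invr_gt0.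
  have W0 : 0 < W.
    rewrite /W (bigD1 (blocks M k point)) /=; last by apply/LP; exists point.
    by rewrite ltr_pwDl ?prodr_gt0// sumr_ge0// => u _; apply/ltW/prodr_gt0.
  have LkM : (#|L| <= #|lang X (k * M)|)%N.
    rewrite (leq_trans _ (leq_imset_card (blocks M k \o representative X 0) _))//.
    apply/subset_leq_card/fintype.subsetP => _ /LP[x <-].
    apply/imsetP; exists (word (k * M) 0 x); first exact: word_in_lang.
    by apply/esym/blocks_word; rewrite word_representative.
  have mB := blocks_measurable (M := M) (k := k).
  (* Each block containing a halves the weight, so the cross entropy is ln W plus ln 2 times the
     expected number k t of such blocks. *)
  pose r u := if u \in L then (\prod_i w (u i)) / W else 0.
  have r0 u : 0 <= r u.
    by rewrite /r; case: ifP => // _; rewrite divr_ge0 ?ltW// prodr_gt0.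
  have r1 : \sum_u r u <= 1 by rewrite -big_mkcond /= -big_distrl /= divff ?gt_eqF.
  have rpos x : 0 < r (blocks M k x).
    rewrite /r ifT; last by apply/LP; exists x.
    by rewrite divr_gt0// prodr_gt0.
  have H1 := partition_entropy_le_cross mu mB r0 r1 rpos.
  have H2 : block_entropy mu (k * M) <= partition_entropy mu (blocks M k : pointsB -> _).
    pose h u := word (k * M) 0 (get (fun x : points X => blocks M k x = u)).
    rewrite (_ : block_entropy mu (k * M) =
      partition_entropy mu (h \o (blocks M k : pointsB -> _))).
      exact: partition_entropy_le.
    rewrite /block_entropy; congr partition_entropy; apply/funext => x /=.
    apply/esym/blocks_word.
    by apply: (@getPex _ (fun y : points X => blocks M k y = _)); exists x.
  have H3 : - (\sum_u law mu (blocks M k) u * ln (r u)) = ln W + k%:R * (t * ln 2).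
    have lawE u : law mu (blocks M k) u * ln (r u) =
        law mu (blocks M k) u * (- ln W) -
        \sum_(i < k) (if u i \in G then law mu (blocks M k) u * ln 2 else 0).
      have [->|/law_neq0[x xu]] := eqVneq (law mu (blocks M k) u) 0.
        rewrite !mul0r big1 ?subr0// => i _; by case: ifP.
      have uL : u \in L by apply/LP; exists x.
      rewrite /r uL ln_div ?posrE ?prodr_gt0// ln_prod// mulrBr mulrN addrC.
      congr (_ + _); rewrite big_distrr -sumrN /=; apply: eq_bigr => i _.
      by rewrite /w; case: ifP => _; rewrite ?lnV ?posrE ?mulrN// ln1 mulr0 oppr0.
    under eq_bigr do rewrite lawE.
    rewrite sumrB -big_distrl /= law_sum1// mul1r opprB addrC opprK; congr (_ + _).
    rewrite exchange_big /= mulr_natl -[k in RHS]card_ord -sumr_const.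
    apply: eq_bigr => i _; rewrite -big_mkcond -big_distrl /= law_sum//.
    congr (_ * _); rewrite /t -(word_preimage_invariant inv (i * M)%N%:Z).
    have e (x : pointsB) : blocks M k x i = word M (i * M)%N%:Z (x : points X).
      by rewrite ffunE.
    congr (fine (mu _)); apply/seteqP; split=> x.
      by rewrite -[_ x]/(is_true (blocks M k x i \in G)) e.
    by rewrite -[X in _ -> X]/(is_true (blocks M k x i \in G)) e.
  have M0 : 0 < #|lang X M|%:R :> R by rewrite ltr0n card_lang_gt0.
  have q0 : 0 < (2 * #|lang X M|%:R)^-1 :> R by rewrite invr_gt0 mulr_gt0.
  have q1 : (2 * #|lang X M|%:R)^-1 < 1 :> R.
    rewrite invf_lt1 ?mulr_gt0// -natrM ltr1n.
    by have := card_lang_gt0 X M; lia.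
  set q : R := (2 * _)^-1 in Wle q0 q1 *.
  have lnW : ln W <= ln #|lang X (k * M)|%:R - k%:R * q.
    have L0 : (0 < #|L|)%N.
      by apply/card_gt0P; exists (blocks M k point); apply/LP; exists point.
    have q1' : 0 < 1 - q by rewrite subr_gt0.
    apply: (@le_trans _ _ (ln (#|L|%:R * (1 - q) ^+ k))).
      by rewrite ler_ln ?posrE ?mulr_gt0 ?ltr0n ?exprn_gt0.
    rewrite lnM ?posrE ?ltr0n ?exprn_gt0// lnXn// lerD//.
      by rewrite ler_ln ?posrE ?ltr0n ?card_lang_gt0 ?ler_nat.
    rewrite -[ln _ *+ k]mulr_natl -mulrN ler_wpM2l ?ler0n//.
    by apply: le_ln1Dx; rewrite ltrN2.
  have ln2 : ln 2 <= 1 :> R.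
    by have := @le_ln1Dx R 1; rewrite -natr1; apply; lra.
  have t0 : 0 <= t by exact: fine_prob_ge0.
  have kt : k%:R * (t * ln 2) <= k%:R * t.
    by rewrite ler_wpM2l ?ler0n// ler_piMr.
  have := unif (k * M)%N; move: H1 H2; rewrite H3; lra.
(* The constant c does not depend on k, so letting k grow removes it. *)
have qt := le_of_linear_growth key.
have LM : #|lang X M|%:R <= #|lang X n|%:R * (#|A| ^ K)%:R :> R.
  by rewrite -natrM ler_nat card_langD_le.
set p := fine _ in tle *.
have p0 : 0 <= p by exact: fine_prob_ge0.
have LM0 : 0 < #|lang X M|%:R :> R by rewrite ltr0n card_lang_gt0.
have : (2 * #|lang X M|%:R)^-1 <= K.+1%:R * p by exact: le_trans tle.
rewrite -div1r ler_pdivrMr ?mulr_gt0// => H.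
rewrite -div1r ler_pdivrMr//; apply: (le_trans H).
rewrite /D; have -> : #|lang X n|%:R * p * (2 * (#|A| ^ K)%:R * K.+1%:R) =
  K.+1%:R * p * (2 * (#|lang X n|%:R * (#|A| ^ K)%:R)) by ring.
by rewrite ler_wpM2l ?mulr_ge0// ler_pM2l.
Qed.

End GibbsLowerBound.

(** * Measures dominated by an ergodic measure *)

Section ErgodicDominated.
Variables (d : measure_display) (T : measurableType d) (R : realType).
Variables (mu nu : probability T R) (S : T -> T).
Hypothesis mS : forall B, measurable B -> measurable (S @^-1` B).

Let f (B : set T) : R := fine (nu B) - fine (mu B).

Lemma fine_probUI (rho : probability T R) (B C : set T) :
  measurable B -> measurable C ->
  fine (rho (B `|` C)) + fine (rho (B `&` C)) = fine (rho B) + fine (rho C).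
Proof.
have DI (E F : set T) : measurable E -> measurable F ->
    fine (rho E) = fine (rho (E `\` F)) + fine (rho (E `&` F)).
  move=> mE mF; apply: EFin_inj; rewrite EFinD !fine_probK//.
  - exact: measureDI.
  - exact: measurableI.
  - exact: measurableD.
move=> mB mC; rewrite (DI (B `|` C) B)//; last exact: measurableU.
rewrite (DI C B)// setUK setDUl setDv set0U [C `&` B]setIC; ring.
Qed.

Lemma fine_probD (rho : probability T R) (B C : set T) :
  measurable B -> measurable C -> C `<=` B ->
  fine (rho B) = fine (rho C) + fine (rho (B `\` C)).
Proof.
move=> mB mC CB; have mBC := measurableD mB mC.
have := fine_probUI rho mC mBC.
by rewrite setDUK// setDIK measure0 addr0.
Qed.

Lemma fine_prob_near (rho : probability T R) (B C : set T) (eps : R) :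
  measurable B -> measurable C -> C `<=` B -> fine (rho (B `\` C)) <= eps ->
  fine (rho C) <= fine (rho B) <= fine (rho C) + eps.
Proof.
move=> mB mC CB e; rewrite (fine_probD _ mB mC CB) lerDl fine_prob_ge0 lerD2l.
exact: e.
Qed.

Let fC B : measurable B -> f (~` B) = - f B.
Proof. by move=> mB; rewrite /f !fine_probC//; ring. Qed.

Let fUI B C : measurable B -> measurable C -> f (B `|` C) + f (B `&` C) = f B + f C.
Proof.
move=> mB mC; rewrite /f.
have := fine_probUI nu mB mC; have := fine_probUI mu mB mC; lra.
Qed.

Let f_increasing (F : nat -> set T) (m : R) : (forall n, measurable (F n)) ->
  {homo F : m n / (m <= n)%N >-> m `<=` n} -> (forall n, f (F n) = m) ->
  f (\bigcup_n F n) = m.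
Proof.
move=> mF Fmono fF; have mU : measurable (\bigcup_n F n) by exact: bigcupT_measurable.
have H (rho : probability T R) e : 0 < e -> exists N, forall n, (N <= n)%N ->
    fine (rho (F n)) <= fine (rho (\bigcup_n F n)) <= fine (rho (F n)) + e.
  move=> e0; have [N NP] := increasing_limit rho mF Fmono e0.
  by exists N => n Nn; apply: fine_prob_near => //; [exact: bigcup_sup|exact: NP].
apply/eqP; rewrite eq_le; apply/andP; split; apply/ler_addgt0Pr => e e0.
  have [N NP] := H nu e e0; have := NP N (leqnn N); have := H mu e e0.
  move=> [N' N'P] _; have := NP _ (leq_maxl N N'); have := N'P _ (leq_maxr N N').
  have := fF (maxn N N'); rewrite /f => <- /andP[a b] /andP[c d']; lra.
have [N NP] := H nu e e0; have [N' N'P] := H mu e e0.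
have := NP _ (leq_maxl N N'); have := N'P _ (leq_maxr N N').
have := fF (maxn N N'); rewrite /f => <- /andP[a b] /andP[c d']; lra.
Qed.

(** The maximum is reached at the positive set of a Hahn decomposition of nu - mu. *)
Let maximum_attained : exists2 P, measurable P &
  forall B, measurable B -> f B <= f P.
Proof.
pose lam := cadd (charge_of_finite_measure nu) (copp (charge_of_finite_measure mu)).
have lamE B : measurable B -> lam B = (f B)%:E.
  by move=> mB; rewrite /lam /cadd /copp /charge_of_finite_measure /f EFinB !fine_probK.
have [P [N [[mP P0] [mN N0] PN PN0]]] := Hahn_decomposition lam.
exists P => // B mB.
have mBP := measurableI _ _ mB mP; have mBN := measurableI _ _ mB mN.
have mPB := measurableD mP mB.
have fU C D : measurable C -> measurable D -> C `&` D = set0 ->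
    f (C `|` D) = f C + f D.
  move=> mC mD CD; have := fUI mC mD; rewrite CD.
  by rewrite {2}/f !measure0 subrr addr0.
have -> : f B = f (B `&` P) + f (B `&` N).
  rewrite -fU//; first by rewrite -setIUr PN setIT.
  by rewrite setIACA PN0 setI0.
have -> : f P = f (B `&` P) + f (P `\` B).
  rewrite -fU//; first by rewrite setIC setUIDK.
  by rewrite setIC setIA setDKI set0I.
rewrite lerD2l (@le_trans _ _ 0)//.
  by rewrite -lee_fin -lamE//; exact: N0 _ mBN (@subIsetr _ _ _).
by rewrite -lee_fin -lamE//; exact: P0 _ mPB (@subDsetl _ _ _).
Qed.

(* The maximizers of [nu - mu] form a lattice closed under monotone limits, so
   they contain an invariant set. *)
Lemma ergodic_dominated :
  ergodic_measure mu S -> invariant_measure nu S ->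
  (forall B, measurable B -> mu B = 0%E -> nu B = 0%E) ->
  forall B, measurable B -> nu B = mu B.
Proof.
move=> [invmu erg] invnu dom.
have [P mP Pmax] := maximum_attained.
pose Q B := measurable B /\ f B = f P.
have QUI B C : Q B -> Q C -> Q (B `|` C) /\ Q (B `&` C).
  move=> [mB fB] [mC fC'].
  have mU := measurableU _ _ mB mC; have mI := measurableI _ _ mB mC.
  have := fUI mB mC; have := Pmax _ mU; have := Pmax _ mI.
  by move=> i u e; split; split=> //; lra.
have mSk k : measurable (iter k S @^-1` P) /\ f (iter k S @^-1` P) = f P.
  elim: k => [//|k [mk fk]].
  have -> : iter k.+1 S @^-1` P = S @^-1` (iter k S @^-1` P).
    by apply/seteqP; split=> x /=; rewrite -iterSr.
  by split; [exact: mS|rewrite -fk /f invmu// invnu].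
(* The limsup W of the sets S^-k P is again a maximizer, and it satisfies S^-1 W = W exactly, as the
   definition of ergodicity demands. *)
pose V n N := \big[setU/set0]_(k < N.+1) (iter (n + k) S @^-1` P).
pose U n := \bigcup_k (iter (n + k) S @^-1` P).
have QV n N : Q (V n N).
  elim: N => [|N IH]; first by rewrite /V big_ord1; exact: mSk.
  by rewrite /V big_ord_recr /=; exact: (QUI _ _ IH (mSk _)).1.
have UE n : U n = \bigcup_N V n N by rewrite /U -bigcup_bigsetU_bigcup.
have QU n : Q (U n).
  rewrite UE; split; first by apply: bigcupT_measurable => N; exact: (QV n N).1.
  apply: f_increasing => [N|N N' NN'|N]; [exact: (QV n N).1| |exact: (QV n N).2].
  rewrite /V -!(bigcup_mkord _ (fun k => iter (n + k) S @^-1` P)) => x [k kN xk].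
  by exists k => //=; exact: leq_trans kN _.
have Udec n n' : (n <= n')%N -> U n' `<=` U n.
  move=> nn' x [k _ xk]; exists (n' - n + k)%N => //.
  by rewrite addnA subnKC.
pose W := \bigcap_n U n.
have mW : measurable W by apply: bigcapT_measurable => n; exact: (QU n).1.
have fW : f W = f P.
  apply: oppr_inj; rewrite -fC// setC_bigcap; apply: f_increasing => [n|n n' nn'|n].
  - by apply: measurableC; exact: (QU n).1.
  - by apply: subsetC; exact: Udec.
  - by rewrite fC; [rewrite (QU n).2|exact: (QU n).1].
have SW : S @^-1` W = W.
  apply/seteqP; split=> x Wx n _.
    have [k _ xk] := Wx n I; exists k.+1 => //.
    by rewrite addnS /= -iterS iterSr.
  have [k _ xk] := Wx n.+1 I; exists k => //.
  by move: xk; rewrite addSn /= -iterS iterSr.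
(* W or its complement is null for mu, hence for nu, so the maximum is 0. Applied to B and to its
   complement this gives equality. *)
have fP0 : f P = 0.
  have [muW|muW] := erg _ mW SW; first by rewrite -fW /f (dom _ mW muW) muW subrr.
  have mC : measurable (~` W) by exact: measurableC.
  have muC : mu (~` W) = 0%E by rewrite probability_setC// muW subee.
  by rewrite -fW -[W]setCK fC// /f (dom _ mC muC) muC subrr oppr0.
move=> B mB; rewrite -(fine_probK nu mB) -(fine_probK mu mB); congr (_%:E).
have := Pmax _ mB; have := Pmax _ (measurableC mB); rewrite fC// fP0 /f; lra.
Qed.

End ErgodicDominated.

(** * Averages along the cellular automaton *)

Lemma pushforward_probability (d : measure_display) (T : measurableType d)
    (R : realType) (mu : probability T R) (f : T -> T) :
  (forall B, measurable B -> measurable (f @^-1` B)) ->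
  exists P : probability T R, forall B, P B = mu (f @^-1` B).
Proof.
move=> mf.
have mf' : measurable_fun setT f by move=> _ B mB; rewrite setTI; exact: mf.
pose F : {mfun T >-> T} :=
  HB.pack_for {mfun T >-> T} f (isMeasurableFun.Build _ _ _ _ f mf').
by exists (distribution mu F).
Qed.

Section Cesaro.
Variables (A : finType) (X : subshift A) (R : realType).
Notation pointsB := (borel (points X)).
Notation sg := (@sigma A X).
Implicit Types mu nu : probability pointsB R.

Lemma window_indic_continuous m (E : set (points X)) : window_set m E ->
  continuous (\1_E : points X -> R).
Proof.
move=> mE; apply/continuousP => U _.
apply: (@window_set_open _ _ m) => x y xy; rewrite /preimage /= !indicE.
suff -> : (x \in E) = (y \in E) by [].
apply/idP/idP => /set_mem; first by move=> Ex; apply/mem_set; exact: mE Ex.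
by move=> Ey; apply/mem_set; exact: mE (ball_windowC xy) Ey.
Qed.

Lemma equal_on_windows mu nu :
  (forall m (E : set (points X)), window_set m E -> nu E = mu E) ->
  forall B, measurable B -> nu B = mu B.
Proof.
move=> eqE B mB; rewrite -(fine_probK nu mB) -(fine_probK mu mB); congr (_%:E).
suff H (e : R) : 0 < e -> fine (nu B) <= fine (mu B) + (e + e) /\
    fine (mu B) <= fine (nu B) + (e + e).
  apply/eqP; rewrite eq_le; apply/andP; split; apply/ler_addgt0Pr => e e0;
    rewrite [e]splitr; have [] // := H (e / 2) (divr_gt0 e0 _).
move=> e0.
have [m [E [mE Ee]]] := borel_approx (fun b => if b then nu else mu) mB e0.
have nuE := Ee true; have muE := Ee false; rewrite /= in nuE muE.
have ME := window_set_measurable mE.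
have := fine_prob_le_symdiff nu mB ME; have := fine_prob_le_symdiff nu ME mB.
have := fine_prob_le_symdiff mu mB ME; have := fine_prob_le_symdiff mu ME mB.
rewrite (eqE _ _ mE) /setdiff_sym ![(E `\` B) `|` _]setUC -!/(setdiff_sym B E).
by move=> a b c d; split; lra.
Qed.

Lemma MME_eq mu nu : (forall B, measurable B -> nu B = mu B) ->
  is_MME mu -> is_MME nu.
Proof.
move=> eqB [inv ent].
have msg (B : set pointsB) k : measurable B -> measurable (iter k sg @^-1` B : set pointsB).
  exact: sigma_preimage_measurable.
split=> [B mB|].
  by rewrite !eqB//; [exact: inv|exact: (msg B 1%N)].
rewrite -ent; congr ereal_sup; apply/seteqP.
have eq_rate k (V : pointsB -> 'I_k) : (forall i, measurable (V @^-1` [set i])) ->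
    partition_entropy_rate nu (sg : pointsB -> pointsB) V =
    partition_entropy_rate mu (sg : pointsB -> pointsB) V.
  move=> mV; congr limn_esup; apply/funext => n; congr (_ * _)%:E; congr (- _).
  have mJ : finite_measurable
      (fun x : pointsB => [ffun i : 'I_n => V (iter i sg x)] : {ffun 'I_n -> 'I_k}).
    have mk (i : 'I_n) : finite_measurable ((fun x => V (iter i sg x)) : pointsB -> 'I_k).
      by move=> j; exact: (msg _ i (mV j)).
    exact: (finite_measurable_ffun mk).
  by apply: eq_bigr => w _; rewrite eqB//; exact: mJ.
by split=> _ [k [V [mV ->]]]; exists k, V; split=> //; rewrite eq_rate.
Qed.

Section CellularAutomaton.
Variables (phi : points X -> points X).
Hypothesis CAphi : cellular_automaton phi.

Lemma CA_iter i : cellular_automaton (iter i phi).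
Proof.
have [cphi sphi] := CAphi; elim: i => [|i [ci si]]; first by split=> // x; exact: cvg_id.
split=> [x|x]; last by rewrite !iterS si sphi.
exact: (continuous_comp (ci x) (cphi _)).
Qed.

Lemma CA_preimage_measurable i (B : set pointsB) : measurable B ->
  measurable (iter i phi @^-1` B : set pointsB).
Proof. by move=> mB; apply: continuous_preimage_borel => //; exact: (CA_iter i).1. Qed.

(** A real-valued form of [cesaro_mean]; the exponent i.+1 matches its sum from 1 to n. *)
Definition orbit_average mu n (B : set pointsB) : R :=
  n%:R^-1 * \sum_(i < n) fine (mu (iter i.+1 phi @^-1` B)).

Lemma orbit_average_cvg mu nu m (E : set (points X)) :
  weak_limit (cesaro_mean mu (phi : pointsB -> pointsB)) nu -> window_set m E ->
  orbit_average mu n E @[n --> \oo] --> fine (nu E).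
Proof.
move=> wl mE; have ME := window_set_measurable mE.
have /choice[P PE] i : exists P : probability pointsB R,
    forall B, P B = mu (iter i.+1 phi @^-1` B).
  by apply: pushforward_probability => B; exact: CA_preimage_measurable.
have n0 n : 0 <= n%:R^-1 :> R by rewrite invr_ge0.
(* The bare set function is identified with a bundled measure, so that the integral of an indicator
   can be evaluated. *)
have cE n : cesaro_mean mu (phi : pointsB -> pointsB) n =
    mscale (NngNum (n0 n)) (msum (P : {measure set pointsB -> \bar R}^nat) n).
  apply/funext => B; rewrite /cesaro_mean /mscale /msum; congr (_ * _)%E.
  by rewrite big_add1 big_mkord; apply: eq_bigr => i _; rewrite [RHS]PE.
have := wl _ (window_indic_continuous mE).
have -> : (\int[nu]_x (\1_E x)%:E)%E = (fine (nu E))%:E.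
  by rewrite integral_indic// setIT fine_probK.
suff -> : (fun n => \int[cesaro_mean mu (phi : pointsB -> pointsB) n]_x (\1_E x)%:E)%E
  = (fun n => (orbit_average mu n E)%:E) by move=> /fine_cvg.
apply/funext => n; rewrite cE integral_indic// setIT /mscale /msum /=.
rewrite /orbit_average EFinM; congr (_ * _)%E; rewrite -sumEFin.
apply: eq_bigr => i _.
exact: (etrans (PE i E) (esym (fine_probK mu (CA_preimage_measurable i.+1 ME)))).
Qed.

End CellularAutomaton.
End Cesaro.

(** * Equicontinuity and entropy *)

Section Equicontinuity.
Variables (A : finType) (X : subshift A) (R : realType).
Notation pointsB := (borel (points X)).
Notation sg := (@sigma A X).
Variables (phi : points X -> points X) (mu : probability pointsB R).
Hypothesis CAphi : cellular_automaton phi.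
Hypothesis inv : invariant_measure mu (sg : pointsB -> pointsB).

Lemma orbit_window_set m k :
  window_set k [set x | ball_window k x `<=` orbit_window phi m x].
Proof.
move=> x y xy xO z yz i j jm.
have zE := xO _ (ball_window_trans xy yz) i j jm.
by have yE := xO _ xy i j jm; rewrite zE yE.
Qed.

Lemma EQ_window (eps : R) : mu (EQ phi) = 1%E -> 0 < eps -> exists k,
  fine (mu (~` [set x | ball_window k x `<=` orbit_window phi 0 x])) <= eps.
Proof.
move=> muEQ eps0.
pose U m k : set (points X) := [set x | ball_window k x `<=` orbit_window phi m x].
have mU m k : measurable (U m k : set pointsB).
  by apply: (@window_set_measurable _ _ k); exact: orbit_window_set.
have Umono m : {homo U m : k l / (k <= l)%N >-> k `<=` l}.
  by move=> k l kl x xO y xy; apply: xO => j jk; apply: xy; lia.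
have mEQ : measurable (EQ phi : set pointsB).
  rewrite (_ : EQ phi = \bigcap_m \bigcup_k U m k).
    by apply: bigcapT_measurable => m; exact: bigcupT_measurable.
  apply/seteqP; split=> x xEQ m; first by move=> _; have [k xk] := xEQ m; exists k.
  by have [k _ xk] := xEQ m I; exists k.
have mUU : measurable (\bigcup_k U 0%N k : set pointsB) by exact: bigcupT_measurable.
have muU : fine (mu (\bigcup_k U 0%N k)) = 1.
  apply/eqP; rewrite eq_le; apply/andP; split.
    by rewrite -lee_fin fine_probK// probability_le1.
  have -> : 1 = fine (mu (EQ phi)) by rewrite muEQ.
  by apply: fine_prob_le => // x /(_ 0%N)[k xk]; exists k.
have [N /(_ N (leqnn N)) NP] := increasing_limit mu (mU 0%N) (Umono 0%N) eps0.
exists N; rewrite fine_probC; last exact: mU.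
by move: NP; rewrite -muU (fine_probD mu mUU (mU 0%N N) (bigcup_sup _))// addrAC subrr add0r.
Qed.

(* Equicontinuity makes the functions x |-> (phi^i x)_0 precompact in measure:
   off a small set they factor through one finite partition into windows. *)
Lemma EQ_precompact (eps : R) : mu (EQ phi) = 1%E -> 0 < eps ->
  exists T (tau : nat -> 'I_T.+1), forall i,
    fine (mu [set x | at_ (iter i phi x) 0 != at_ (iter (tau i) phi x) 0]) <= eps.
Proof.
move=> muEQ eps0; have [k kP] := EQ_window muEQ eps0.
set U := [set x | _] in kP.
have wU : window_set k U by exact: orbit_window_set.
pose n := k.*2.+1.
(* [h i] tabulates (phi^i y)_0 by window words, with [None] where the representative is not in U.
   There are finitely many tables; [ix] selects one time for each, and T is the largest of these
   times. *)
pose h (i : nat) : {ffun {ffun 'I_n -> A} -> option A} :=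
  [ffun w => let y := representative X (- k%:Z) w in
     if `[< U y >] then Some (at_ (iter i phi y) 0) else None].
have /choice[ix ixP] (g : {ffun {ffun 'I_n -> A} -> option A}) :
    exists j, forall i, h i = g -> h j = g.
  have [[i ig]|no] := pselect (exists i, h i = g); first by exists i.
  by exists 0%N => i ig; case: no; exists i.
pose T := (\max_g ix g)%N.
exists T, (fun i => inord (ix (h i))) => i.
rewrite inordK; last by rewrite ltnS; exact: leq_bigmax.
set j := ix (h i); have hij : h j = h i by exact: (ixP _ i).
apply: le_trans kP; apply: fine_prob_le.
- rewrite (_ : [set x | _] = (fun x : pointsB => (at_ (iter i phi x) 0,
    at_ (iter j phi x) 0)) @^-1` [set ab | ab.1 != ab.2]); last first.
    by apply/seteqP; split.
  have mat (l : nat) : finite_measurable ((fun x => at_ (iter l phi x) 0) : pointsB -> A).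
    move=> a; apply: (@CA_preimage_measurable _ _ _ CAphi l [set x | at_ x 0 = a]).
    by apply: borel_open; exact: open_at.
  by apply: finite_measurable_preimage; exact: finite_measurable_pair.
- by apply: measurableC; exact: window_set_measurable wU.
move=> x /= + Ux; apply/negP; rewrite negbK; apply/eqP.
set y := representative X (- k%:Z) (word n (- k%:Z) x).
have xy : ball_window k x y.
  move=> l lk; have := word_representative n (- k%:Z) x.
  move=> /word_eqP/(_ `|(l + k%:Z)%R|%N).
  rewrite (_ : - k%:Z + `|(l + k%:Z)%R|%N%:Z = l); last by lia.
  by apply; rewrite /n; lia.
have Uy : U y := wU _ _ xy Ux.
have yE l : at_ (iter l phi y) 0 = at_ (iter l phi x) 0 by exact: (Ux _ xy l 0).
move/ffunP/(_ (word n (- k%:Z) x)): hij; rewrite !ffunE /= -/y asboolT//.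
by move=> -[]; rewrite !yE => ->.
Qed.

Lemma iter_CA_sigma i l x : iter i phi (iter l sg x) = iter l sg (iter i phi x).
Proof. exact: (CA_sigma_iter (CA_iter CAphi i)). Qed.

(** Draw i uniformly and x from mu. The k-word of phi^(i+1) x is guessed from a window of x by
    phi^tau(i+1), with a small error at each coordinate. The margin m = 2r comes from the largest
    radius among phi^t with t <= T, so neither m nor T depends on k or on n. *)
Lemma orbit_average_word_entropy_le (eta : R) : mu (EQ phi) = 1%E -> 0 < eta ->
  exists m T, forall k n, (0 < n)%N ->
  - (\sum_(u : {ffun 'I_k -> A}) let q := orbit_average phi mu n (word k 0 @^-1` [set u])
      in q * ln q) <= block_entropy mu (k + m) + ln T.+1%:R + k%:R * eta.
Proof.
move=> muEQ eta0; have [eps eps0 hamming] := @entropy_of_hamming R A _ eta0.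
have [T [tau tauP]] := EQ_precompact muEQ eps0.
have /choice[rad radP] (t : 'I_T.+1) := CA_radius (CA_iter CAphi t).
pose r := (\max_t rad t)%N.
exists (r + r)%N, T => k n n0.
pose F (t : 'I_T.+1) (z : {ffun 'I_(k + (r + r)) -> A}) : {ffun 'I_k -> A} :=
  word k 0 (iter t phi (representative X (- r%:Z) z)).
pose Z := word (k + (r + r)) (- r%:Z) : pointsB -> {ffun 'I_(k + (r + r)) -> A}.
have FZ t (x : points X) : F t (Z x) = word k 0 (iter t phi x).
  apply/word_eqP => l lk; apply: radP => j jr.
  have rr : (rad t <= r)%N by exact: leq_bigmax.
  have := word_representative (k + (r + r)) (- r%:Z) x.
  move=> /word_eqP/(_ `|(l%:Z + j + r%:Z)%R|%N).
  rewrite (_ : - r%:Z + `|(l%:Z + j + r%:Z)%R|%N%:Z = 0 + l%:Z + j); last by lia.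
  by apply; lia.
pose V (i : 'I_n) := (fun x => word k 0 (iter i.+1 phi x)) : pointsB -> {ffun 'I_k -> A}.
have mV i : finite_measurable (V i).
  move=> w; apply: (@CA_preimage_measurable _ _ _ CAphi i.+1 (word k 0 @^-1` [set w])).
  exact: (@word_measurable A X k 0).
have mZ : finite_measurable Z by exact: word_measurable.
have mVV := finite_measurable_ffun mV.
pose W := (fun x => ([ffun i => V i x], Z x)) : pointsB -> _.
have mW : finite_measurable W by exact: finite_measurable_pair.
(* A finite model of the pair (i, x): an index, uniform and independent of the rest, with all n
   image words and the window word of x. *)
pose Om := ('I_n * ({ffun 'I_n -> {ffun 'I_k -> A}} * {ffun 'I_(k + (r + r)) -> A}))%type.
pose p (w : Om) : R := n%:R^-1 * law mu W w.2.
have n0R : 0 < n%:R :> R by rewrite ltr0n.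
have p0 w : 0 <= p w by rewrite mulr_ge0 ?invr_ge0 ?ler0n// law_ge0.
have psum (Q : 'I_n -> pred _) : \sum_(w | Q w.1 w.2) p w =
    n%:R^-1 * \sum_i fine (mu (W @^-1` [set` Q i])).
  rewrite -(pair_big_dep xpredT Q (fun i w => p (i, w))) /= big_distrr /=.
  by apply: eq_bigr => i _; rewrite -(law_sum mu mW) big_distrr.
have p1 : \sum_w p w = 1.
  rewrite (psum (fun=> xpredT)) (eq_bigr (fun=> 1)); last first.
    by move=> i _; rewrite (_ : _ @^-1` _ = setT) ?probability_setT//; apply/seteqP; split.
  by rewrite sumr_const card_ord mulVf ?gt_eqF.
have := hamming Om p p0 p1 k (fun w => w.2.1 w.1) _ (fun w => w.2.2) T F
  (fun w => tau w.1.+1).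
have -> : entropy_of p (fun w : Om => w.2.1 w.1) =
  - (\sum_(u : {ffun 'I_k -> A}) let q := orbit_average phi mu n (word k 0 @^-1` [set u])
      in q * ln q).
  rewrite /entropy_of; congr (- _); apply: eq_bigr => u _ /=.
  suff -> : law_of p (fun w : Om => w.2.1 w.1) u =
    orbit_average phi mu n (word k 0 @^-1` [set u]) by [].
  rewrite /law_of (psum (fun i w => w.1 i == u)) /orbit_average; congr (_ * _).
  apply: eq_bigr => i _; congr (fine (mu _)).
  by apply/seteqP; split=> x; rewrite /= unfold_in /= ffunE => /eqP.
have -> : entropy_of p (fun w : Om => w.2.2) = block_entropy mu (k + (r + r)).
  rewrite -(partition_entropy_word inv _ (- r%:Z)) -/Z.
  rewrite -[Z]/(snd \o W) (partition_entropyE mu mW) /entropy_of.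
  congr (- _); apply: eq_bigr => z _.
  suff -> : law_of p (fun w : Om => w.2.2) z = law_of (law mu W) snd z by [].
  rewrite /law_of (psum (fun=> fun w => w.2 == z)) sumr_const card_ord.
  by rewrite -[fine _ *+ n]mulr_natl mulKf ?gt_eqF// law_sum.
apply=> j; rewrite (psum (fun i w => w.1 i j != F (tau i.+1) w.2 j)).
rewrite ler_pdivrMl//.
have -> : n%:R * eps = \sum_(i < n) eps by rewrite sumr_const card_ord mulr_natl.
apply: ler_sum => i _; apply: le_trans (tauP i.+1).
pose D := [set x : points X | at_ (iter i.+1 phi x) 0 != at_ (iter (tau i.+1) phi x) 0].
have mat (l : nat) : finite_measurable ((fun x => at_ (iter l phi x) 0) : pointsB -> A).
  move=> a; apply: (@CA_preimage_measurable _ _ _ CAphi l [set x | at_ x 0 = a]).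
  by apply: borel_open; exact: open_at.
have mD : measurable (D : set pointsB).
  rewrite (_ : D = (fun x : pointsB => (at_ (iter i.+1 phi x) 0,
    at_ (iter (tau i.+1) phi x) 0)) @^-1` [set ab | ab.1 != ab.2]); last first.
    by apply/seteqP; split.
  by apply: finite_measurable_preimage; exact: finite_measurable_pair.
(* Invariance under sigma and commutation with phi move an error at coordinate j to coordinate 0. *)
rewrite -/D -(iter_sigma_invariant inv j mD) (_ : _ @^-1` _ = iter j sg @^-1` D)//.
have e (x : points X) : ([ffun i => V i x] : {ffun 'I_n -> _}) i j =
    at_ (iter i.+1 phi (iter j sg x)) 0.
  by rewrite !ffunE iter_CA_sigma at_iter_sigma add0r.
have e' (x : points X) : F (tau i.+1) (Z x) j = at_ (iter (tau i.+1) phi (iter j sg x)) 0.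
  by rewrite FZ ffunE iter_CA_sigma at_iter_sigma add0r.
by apply/seteqP; split=> x; rewrite /= unfold_in /= e e'.
Qed.

Lemma orbit_average_ge0 n B : 0 <= orbit_average phi mu n B.
Proof. by rewrite mulr_ge0 ?invr_ge0// sumr_ge0// => i _; exact: fine_prob_ge0. Qed.

Lemma orbit_average_le1 n B : measurable B -> orbit_average phi mu n B <= 1.
Proof.
move=> mB; have [->|n0] := posnP n; first by rewrite /orbit_average invr0 mul0r.
rewrite /orbit_average ler_pdivrMl ?ltr0n// mulr1 -[n in leRHS]card_ord -sumr_const.
apply: ler_sum => i _; rewrite -lee_fin fine_probK ?probability_le1//.
all: exact: (CA_preimage_measurable CAphi i.+1).
Qed.

Lemma limit_entropy_le nu (eta : R) :
  weak_limit (cesaro_mean mu (phi : pointsB -> pointsB)) nu ->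
  mu (EQ phi) = 1%E -> 0 < eta -> exists m (c : R), forall k,
    block_entropy nu k <= block_entropy mu (k + m) + c + k%:R * eta.
Proof.
move=> wl muEQ eta0; have [m [T mTP]] := orbit_average_word_entropy_le muEQ eta0.
exists m, (ln T.+1%:R) => k.
have wcyl u : window_set k (word k 0 @^-1` [set u] : set (points X)).
  move=> x y xy <-; apply/word_eqP => l lk; apply: xy; lia.
pose q n u := orbit_average phi mu n (word k 0 @^-1` [set u]).
pose q0 u := fine (nu (word k 0 @^-1` [set u])).
have cq u : q n u @[n --> \oo] --> q0 u by exact: orbit_average_cvg wl (wcyl u).
have q01 n u : 0 <= q n u <= 1.
  by rewrite orbit_average_ge0 orbit_average_le1//; exact: window_set_measurable (wcyl u).
(* Keeping only the words of positive limit mass avoids the logarithm at 0; the omitted terms are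
   nonnegative, so the upper bound survives. *)
pose s n := \sum_(u | 0 < q0 u) - (q n u * ln (q n u)).
have s_le n : (0 < n)%N -> s n <= block_entropy mu (k + m) + ln T.+1%:R + k%:R * eta.
  move=> n0; apply: le_trans (mTP k n n0); rewrite -sumrN /s.
  rewrite big_mkcond /=; apply: ler_sum => u _ /=; case: ifP => // _.
  have /andP[a b] := q01 n u.
  by rewrite oppr_ge0 mulr_ge0_le0// ln_le0.
have s_cvg : s n @[n --> \oo] --> \sum_(u | 0 < q0 u) - (q0 u * ln (q0 u)).
  apply: cvg_big => [|u u0]; first exact: add_continuous.
  apply: cvgN; apply: cvgM; first exact: cq.
  by apply: continuous_cvg; [exact: continuous_ln|exact: cq].
have -> : block_entropy nu k = \sum_(u | 0 < q0 u) - (q0 u * ln (q0 u)).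
  rewrite /block_entropy /partition_entropy -sumrN [RHS]big_mkcond /=.
  apply: eq_bigr => u _; case: ifPn => //; rewrite -leNgt -/(q0 u) => q00.
  have -> : q0 u = 0 by apply/eqP; rewrite eq_le q00 fine_prob_ge0.
  by rewrite mul0r oppr0.
by apply: cvgr_to_le s_cvg _; exists 1%N => // n /= n1; exact: s_le.
Qed.

End Equicontinuity.

(** * The two directions *)

Section Directions.
Variables (A : finType) (X : subshift A) (R : realType).
Notation pointsB := (borel (points X)).
Notation sg := (@sigma A X).
Variables (phi : points X -> points X) (mu : probability pointsB R).
Hypothesis sftX : is_SFT X.
Hypothesis irrX : irreducible X.
Hypothesis CAphi : cellular_automaton phi.

Lemma sigma_preimage_measurable1 (B : set pointsB) : measurable B ->
  measurable (sg @^-1` B : set pointsB).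
Proof. exact: (@sigma_preimage_measurable _ _ 1). Qed.

Lemma surjective_preserves_MME : ergodic_measure mu (sg : pointsB -> pointsB) ->
  is_MME mu -> set_surj [set: points X] [set: points X] phi ->
  forall B : set pointsB, measurable B -> mu (phi @^-1` B) = mu B.
Proof.
move=> erg mme surj B mB; have [c cP] := MME_near_uniform R sftX irrX.
have [inv ergB] := erg; have unif := cP _ mme.
have [g g0 gibbs] := near_uniform_gibbs sftX irrX inv unif.
have mphi (C : set pointsB) : measurable C -> measurable (phi @^-1` C : set pointsB).
  exact: (CA_preimage_measurable CAphi 1).
have [rho rhoE] := pushforward_probability mu mphi.
have [cphi sphi] := CAphi.
have sphiE (C : set (points X)) : phi @^-1` (sg @^-1` C) = sg @^-1` (phi @^-1` C).
  by apply/seteqP; split=> x /=; rewrite sphi.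
have rho_inv : invariant_measure rho (sg : pointsB -> pointsB).
  by move=> C mC; rewrite !rhoE sphiE inv//; exact: mphi.
have rho_erg : ergodic_measure rho (sg : pointsB -> pointsB).
  split=> // C mC CE; rewrite rhoE; apply: ergB; first exact: mphi.
  by rewrite -sphiE CE.
have [r rP] := CA_radius CAphi.
have A0 : (0 < #|A|)%N by apply/card_gt0P; exists (at_ (point : points X) 0).
have Ar0 : 0 < (#|A| ^ (r + r))%:R :> R by rewrite ltr0n expn_gt0 A0.
(* Surjectivity provides a point above the word a; its window of length n + 2r determines a. The
   loss |A|^(2r) bounds |L_(n+2r)| / |L_n|. *)
have rho_gibbs : gibbs_lower rho (g / (#|A| ^ (r + r))%:R).
  move=> n a aL; have [y ya] := lang_point 0 aL.
  have [x _ xy] := surj y I.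
  pose b := word (n + (r + r)) (- r%:Z) x.
  have bsub : word (n + (r + r)) (- r%:Z) @^-1` [set b] `<=`
      phi @^-1` (word n 0 @^-1` [set a]).
    move=> z zb; rewrite /preimage /= -ya -xy; apply/word_eqP => i ilt.
    apply: rP => k kr; move/word_eqP/(_ `|(i%:Z + k + r%:Z)%R|%N): zb.
    rewrite (_ : - r%:Z + `|(i%:Z + k + r%:Z)%R|%N%:Z = 0 + i%:Z + k); last by lia.
    by apply; lia.
  rewrite rhoE ler_pdivrMr//.
  have /le_trans := gibbs _ b (word_in_lang _ _ _); apply.
  rewrite -(word_preimage_invariant inv (- r%:Z)) mulrAC.
  apply: ler_pM; [exact: ler0n|exact: fine_prob_ge0| |].
    by rewrite -natrM ler_nat card_langD_le.
  apply: fine_prob_le => //; first exact: word_measurable.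
  by apply: mphi; exact: word_measurable.
have g'0 : 0 < g / (#|A| ^ (r + r))%:R by rewrite divr_gt0.
have dom := near_uniform_dominated inv rho_inv unif g'0 rho_gibbs.
rewrite -rhoE; apply/esym.
exact: (ergodic_dominated sigma_preimage_measurable1 rho_erg inv dom).
Qed.

Lemma limit_MME_surjective nu :
  weak_limit (cesaro_mean mu (phi : pointsB -> pointsB)) nu -> is_MME nu ->
  set_surj [set: points X] [set: points X] phi.
Proof.
move=> wl mme; have [c cP] := MME_near_uniform R sftX irrX.
have [g g0 gibbs] := near_uniform_gibbs sftX irrX mme.1 (cP _ mme).
apply: contrapT => /(CA_not_surjective_window CAphi)[y [m ym]].
have wE : window_set m (ball_window m y).
  by move=> x z xz yx; exact: ball_window_trans xz.
have cE := orbit_average_cvg CAphi wl wE.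
have nu0 : fine (nu (ball_window m y)) <= 0.
  (* The averages start at phi^1, so each term is carried by phi(X) and gives the missed window
     measure 0. *)
  apply: (cvgr_to_le cE); apply: nearW => n; rewrite /orbit_average big1 ?mulr0// => i _.
  rewrite (_ : _ @^-1` _ = set0) ?measure0// -subset0 => x /=.
  exact: ym.
pose a := word m.*2.+1 (- m%:Z) y.
have aL : a \in lang X m.*2.+1 by exact: word_in_lang.
have := gibbs _ a aL; rewrite leNgt => /negP; apply.
rewrite (le_lt_trans _ g0)// mulr_ge0_le0//.
apply: le_trans nu0; rewrite -(word_preimage_invariant mme.1 (- m%:Z)).
apply: fine_prob_le; [exact: word_measurable|exact: window_set_measurable wE|].
move=> x /word_eqP xa j jm; have := xa `|(j + m%:Z)%R|%N.
rewrite (_ : - m%:Z + `|(j + m%:Z)%R|%N%:Z = j); last by lia.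
by apply; lia.
Qed.

Lemma limit_MME_eq nu : ergodic_measure mu (sg : pointsB -> pointsB) ->
  mu (EQ phi) = 1%E ->
  weak_limit (cesaro_mean mu (phi : pointsB -> pointsB)) nu -> is_MME nu ->
  forall B : set pointsB, measurable B -> nu B = mu B.
Proof.
move=> erg muEQ wl mme; have [c cP] := MME_near_uniform R sftX irrX.
have nunif := cP _ mme; have inv := erg.1.
have [C C0 sup] := lang_supmul sftX irrX.
(* For fixed n, n ln |L_k| is bounded below by k (ln |L_n| - ln C) and above, through the k-words of
   nu and the (k+m)-words of mu, by k (H_n(mu) + e) plus a constant; then k tends to infinity. The
   choice e / n anticipates the multiplication by n. *)
have unif : near_uniform mu (ln C%:R).
  move=> n; have [->|n0] := posnP n.
    apply: le_trans (block_entropy_ge0 inv 0).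
    rewrite lerBlDr add0r (@le_trans _ _ 0)// ?ln_ge0 ?ler1n//.
    by rewrite ln_le0// lern1 (leq_trans (card_lang_le X 0)).
  apply/ler_addgt0Pr => e e0; have n0R : 0 < n%:R :> R by rewrite ltr0n.
  have en : 0 < e / n%:R by rewrite divr_gt0.
  have [m [d dP]] := limit_entropy_le CAphi inv wl muEQ en.
  apply: (@le_of_linear_growth _ _ _
    ((m + n)%:R * block_entropy mu n + n%:R * d + n%:R * c)) => k.
  have H1 := lang_growth R n k C0 sup.
  have H2 : n%:R * ln #|lang X k|%:R <= n%:R * (block_entropy nu k + c).
    by rewrite ler_wpM2l ?ler0n// -lerBlDr; exact: nunif.
  have H3 := ler_wpM2l (ltW n0R) (dP k).
  have H4 := block_entropy_rate inv (k + m) n0.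
  have H5 : n%:R * (k%:R * (e / n%:R)) = k%:R * e by field; rewrite gt_eqF.
  move: H2 H3 H4; rewrite !mulrDr H5 !natrD => H2 H3 H4; lra.
have [g g0 gibbs] := near_uniform_gibbs sftX irrX inv unif.
have dom := near_uniform_dominated mme.1 inv nunif g0 gibbs.
exact: ergodic_dominated sigma_preimage_measurable1 erg mme.1 dom.
Qed.

Lemma limit_eq_of_preserved nu :
  weak_limit (cesaro_mean mu (phi : pointsB -> pointsB)) nu ->
  (forall B : set pointsB, measurable B -> mu (phi @^-1` B) = mu B) ->
  forall B : set pointsB, measurable B -> nu B = mu B.
Proof.
move=> wl pres; apply: equal_on_windows => m E wE.
have ME := window_set_measurable wE.
rewrite -(fine_probK nu ME) -(fine_probK mu ME); congr (_%:E).
have iterE i : mu (iter i phi @^-1` E) = mu E.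
  elim: i => [//|i IH].
  rewrite (_ : _ @^-1` E = phi @^-1` (iter i phi @^-1` E)).
    by rewrite pres//; exact: (CA_preimage_measurable CAphi i).
  by apply/seteqP; split=> x /=; rewrite -iterSr.
apply: (cvg_unique _ (orbit_average_cvg CAphi wl wE)) => //.
apply: cvg_near_cst; exists 1%N => // n /= n1; apply/eqP.
rewrite /orbit_average; under eq_bigr do rewrite iterE.
by rewrite sumr_const card_ord -[fine _ *+ n]mulr_natl mulKf// pnatr_eq0 -lt0n.
Qed.

End Directions.

Theorem theorem3p16 (R : realType) (A : finType) (X : subshift A)
    (phi : points X -> points X)
    (mu mu_inf : probability (borel (points X)) R) :
  is_SFT X -> irreducible X ->
  cellular_automaton phi ->
  ergodic_measure mu (@sigma A X) ->
  mu (EQ phi) = 1%E ->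
  weak_limit (cesaro_mean mu phi) mu_inf ->
  is_MME mu_inf <-> (is_MME mu /\ set_surj [set: points X] [set: points X] phi).
Proof.
move=> sft irr CAphi erg muEQ wl; split=> [mme|[mme surj]].
  split; last exact: limit_MME_surjective wl mme.
  apply: (MME_eq _ mme) => B mB; apply/esym.
  exact: (limit_MME_eq sft irr CAphi erg muEQ wl mme).
apply: (MME_eq _ mme); apply: (limit_eq_of_preserved CAphi wl).
exact: surjective_preserves_MME.
Qed.
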